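(* For every face $F$ of $ASM_n$, the dimension of $F$ equals the number of doubly directed regions in the elementary flow grid $g(F)$. In particular, the edges (one-dimensional faces) of $ASM_n$ are represented by the elementary flow grids containing exactly one cycle of double directed edges.
   Context: An alternating sign matrix (ASM) is a square matrix with entries in $\{0,1,-1\}$ such that the entries of each row and each column sum to $1$, and the nonzero entries in each row and each column alternate in sign. $ASM_n$ is the convex hull in $\mathbb{R}^{n^2}$ of the $n\times n$ ASMs; its vertices are the ASMs. The complete flow grid $C_n$ is the directed graph with internal vertices $(i,j)$, $1\le i,j\le n$, and boundary vertices $(i,0),(0,j),(i,n+1),(n+1,j)$, $1\le i,j\le n$ (vertex $(i,j)$ drawn at row $i$, column $j$ of a grid), with edge set $\{((i,j),(i,j\pm1)),((i,j),(i\pm1,j)) : 1\le i,j\le n\}$. A simple flow grid of order $n$ is a subgraph of $C_n$ containing all vertices of $C_n$ in which each internal vertex has exactly four incident edges, either all directed inward, all directed outward, or with the two horizontal edges pointing in the same direction and the two vertical edges pointing in the same direction. For an ASM $A=(a_{ij})$, $g(A)$ is the simple flow grid containing an edge $(v,w)$ of $C_n$, $v=(i,j)$, iff the partial sum of the row (for horizontal $(v,w)$) or column (for vertical $(v,w)$) of $A$ from the border on the side opposite $w$ up to and including $a_{ij}$ equals $1$. For a face $F$, $g(F)=\bigcup_{A \text{ vertex of } F} g(A)$ (union of edge sets). An elementary flow grid is a subgraph of $C_n$ whose edge set is a union of edge sets of simple flow grids. In an elementary flow grid $G$, a double directed edge is a pair of neighbouring vertices joined by edges in both directions; a doubly directed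 region is a collection of cells (unit squares of the drawn grid) completely bounded by double directed edges of $G$ but containing no double directed edges of $G$ in its interior. *)

(* Defs.v *)
From HB Require Import structures.
From mathcomp Require Import all_boot all_order all_algebra.
From mathcomp Require Import boolp classical_sets reals.

Set Implicit Arguments.
Unset Strict Implicit.
Unset Printing Implicit Defensive.

Import Order.TTheory GRing.Theory Num.Theory.
Local Open Scope ring_scope.

Section Polytopes.
Variables (R : realType) (n : nat).
Implicit Types (S P F : set 'M[R]_n) (A X : 'M[R]_n).

Definition conv_hull S : set 'M[R]_n :=
  [set X | exists (k : nat) (p : 'I_k -> 'M[R]_n) (a : 'I_k -> R),
     [/\ forall i, S (p i), forall i, 0 <= a i, \sum_i a i = 1
       & X = \sum_i a i *: p i]]%classic.

Definition aff_hull S : set 'M[R]_n :=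
  [set X | exists (k : nat) (p : 'I_k -> 'M[R]_n) (a : 'I_k -> R),
     [/\ forall i, S (p i), \sum_i a i = 1 & X = \sum_i a i *: p i]]%classic.

(* The affine hull of S is a translate of a d-dimensional linear subspace;
   the empty set has no dimension in this sense. *)
Definition has_dim S (d : nat) : Prop :=
  exists (X0 : 'M[R]_n) (U : {vspace 'M[R]_n}),
    aff_hull S = [set X | X - X0 \in U]%classic /\ \dim U = d.

Definition dotmx A X : R := \sum_i \sum_j A i j * X i j.

(* Both improper faces are included: P itself (C = 0, b = 0) and the empty set
   (C = 0, b = 1). *)
Definition is_face P F : Prop :=
  exists (C : 'M[R]_n) (b : R),
    (forall X, P X -> dotmx C X <= b) /\
    F = [set X | P X /\ dotmx C X = b]%classic.

Definition is_vertex P A : Prop := is_face P [set A]%classic.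

Definition is_ASM A : Prop :=
  [/\ forall i j, [\/ A i j = 0, A i j = 1 | A i j = -1],
      forall i, \sum_j A i j = 1,
      forall j, \sum_i A i j = 1,
      forall i (j k : 'I_n), (j < k)%N -> A i j != 0 -> A i k != 0 ->
        (forall l : 'I_n, (j < l < k)%N -> A i l = 0) -> A i k = - A i j
    & forall j (i k : 'I_n), (i < k)%N -> A i j != 0 -> A k j != 0 ->
        (forall l : 'I_n, (i < l < k)%N -> A l j = 0) -> A k j = - A i j].

Definition ASM_polytope : set 'M[R]_n := conv_hull is_ASM.

End Polytopes.

Section FlowGrids.
Variable n : nat.

(* (i, j) is the vertex at row i, column j of the drawn grid, 0 <= i, j <= n+1.
   The four extra pairs (0, 0), (0, n+1), (n+1, 0), (n+1, n+1) are not vertices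
   of the complete flow grid; no edge of it is incident to them. *)
Definition vertex : finType := ('I_n.+2 * 'I_n.+2)%type.
(* (v, w) is directed from v to w.  Since all grids have the same vertices, a
   grid is identified with its edge set. *)
Definition edge : finType := (vertex * vertex)%type.
Definition grid : finType := {set edge}.

Definition internal (v : vertex) : bool :=
  (0 < v.1 <= n)%N && (0 < v.2 <= n)%N.

Definition rightward (e : edge) : bool :=
  (e.2.1 == e.1.1) && (e.2.2 == e.1.2.+1 :> nat).
Definition leftward (e : edge) : bool :=
  (e.2.1 == e.1.1) && (e.1.2 == e.2.2.+1 :> nat).
Definition downward (e : edge) : bool :=
  (e.2.2 == e.1.2) && (e.2.1 == e.1.1.+1 :> nat).
Definition upward (e : edge) : bool :=
  (e.2.2 == e.1.2) && (e.1.1 == e.2.1.+1 :> nat).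

Definition horizontal (e : edge) : bool := rightward e || leftward e.
Definition vertical (e : edge) : bool := downward e || upward e.

Definition complete_flow_grid : grid :=
  [set e : edge | internal e.1 && (horizontal e || vertical e)]%SET.

Definition incident (G : grid) (v : vertex) : {set edge} :=
  [set e in G | (e.1 == v) || (e.2 == v)]%SET.

Definition same_direction (H : {set edge}) : bool :=
  [|| [forall e in H, rightward e], [forall e in H, leftward e],
      [forall e in H, downward e] | [forall e in H, upward e]].

Definition two_parallel (H : {set edge}) : bool :=
  (#|H| == 2%N) && same_direction H.

Definition simple_flow_grid (G : grid) : bool :=
  (G \subset complete_flow_grid) &&
  [forall v : vertex, internal v ==>
     (#|incident G v| == 4%N) &&
     [|| [forall e in incident G v, e.2 == v],
         [forall e in incident G v, e.1 == v]
       | two_parallel [set e in incident G v | horizontal e]%SET &&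
         two_parallel [set e in incident G v | vertical e]%SET]].

Definition elementary_flow_grid (G : grid) : Prop :=
  exists2 X : {set grid}, {in X, forall S, simple_flow_grid S}
                        & G = (\bigcup_(S in X) S)%SET.

Definition double_directed (G : grid) (v w : vertex) : bool :=
  ((v, w) \in G) && ((w, v) \in G).

(* A cycle of length at least 3 in the undirected graph of double directed
   edges, represented by the symmetric closure of its edge set so that the base
   point and the direction of travel are forgotten. *)
Definition cycle_edges (c : seq vertex) : {set edge} :=
  [set e : edge | (e.1 \in c) && (e.2 == next c e.1)
               || (e.2 \in c) && (e.1 == next c e.2)]%SET.

Definition double_directed_cycle (G : grid) (E : {set edge}) : Prop :=
  exists c : seq vertex,
    [/\ (2 < size c)%N, ucycle (double_directed G) c & E = cycle_edges c].

(* The cell (i, j) is the unit square whose corners are the internal vertices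
   (i+1, j+1), (i+1, j+2), (i+2, j+1), (i+2, j+2). *)
Definition cell : finType := ('I_n.-1 * 'I_n.-1)%type.

Definition vtx (i j : nat) : vertex := (inord i, inord j).

Definition sides (c : cell) : {set edge} :=
  let tl := vtx c.1.+1 c.2.+1 in let tr := vtx c.1.+1 c.2.+2 in
  let bl := vtx c.1.+2 c.2.+1 in let br := vtx c.1.+2 c.2.+2 in
  [set (tl, tr); (bl, br); (tl, bl); (tr, br)]%SET.

(* Number of cells of S having s as a side: a segment is on the boundary of S
   when this is 1, and in its interior when this is 2. *)
Definition side_count (S : {set cell}) (s : edge) : nat :=
  #|[set c in S | s \in sides c]%SET|.

Definition cell_adj (S : {set cell}) : rel cell :=
  fun c d => [&& c \in S, d \in S & sides c :&: sides d != finset.set0]%SET.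

Definition cell_connected (S : {set cell}) : bool :=
  (S != finset.set0) && [forall c in S, forall d in S, connect (cell_adj S) c d].

Definition doubly_directed_region (G : grid) (S : {set cell}) : bool :=
  [&& cell_connected S,
      [forall s : edge, (side_count S s == 1%N) ==> double_directed G s.1 s.2]
    & [forall s : edge, (side_count S s == 2%N) ==> ~~ double_directed G s.1 s.2]].

Definition num_regions (G : grid) : nat :=
  #|[set S : {set cell} | doubly_directed_region G S]%SET|.

Section FromMatrices.
Variable R : realType.

(* Sum of the row or column of A from the border opposite to the head of e up
   to and including A i j, where the tail of e is the vertex of the entry
   (i, j). *)
Definition partial_sum (A : 'M[R]_n) (i j : 'I_n) (e : edge) : R :=
  if rightward e then \sum_(k < n | (k <= j)%N) A i k
  else if leftward e then \sum_(k < n | (j <= k)%N) A i k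
  else if downward e then \sum_(k < n | (k <= i)%N) A k j
  else \sum_(k < n | (i <= k)%N) A k j.

Definition flow_grid_of (A : 'M[R]_n) : grid :=
  [set e in complete_flow_grid |
     [exists i : 'I_n, exists j : 'I_n,
        (e.1 == vtx i.+1 j.+1) && (partial_sum A i j e == 1)]]%SET.

Definition flow_grid_of_face (F : set 'M[R]_n) : grid :=
  [set e : edge | `[< exists2 A, is_vertex F A & e \in flow_grid_of A >]]%SET.

End FromMatrices.
End FlowGrids.

(* Main.v *)
Require Import Defs.
From HB Require Import structures.
From mathcomp Require Import all_boot all_order all_algebra.
From mathcomp Require Import boolp classical_sets reals.
From mathcomp Require Import zify ring lra.

(** An alternating sign matrix is encoded by its corner sums, one free value per
    cell of the grid.  The orientation of a segment of the flow grid is the 0/1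
    difference of the corner sums on its two sides, so across a segment that is
    not double directed in [g(F)] this difference is constant on the face [F].
    The directions of [F] are therefore functions on the cells that vanish
    outside the grid and are constant on the components left when the double
    directed edges are removed, i.e. combinations of indicators of regions.
    Conversely, adding the indicator of a region to the corner sums of a sum of
    [N] vertices of [F] that realise all edges of [g(F)] keeps all differences
    in [[0, N]]; rounding (Hermite's identity) writes the result as a sum of [N]
    alternating sign matrices of [F], so every such indicator is a direction.
    The same rounding shows that [F] contains every alternating sign matrix
    whose flow grid lies in [g(F)].

    The jumps of a function on the cells form a circulation on the grid, and
    every circulation arises so.  Circulations supported on double directed
    edges are thus spanned by the regions, while they are also generated by
    cycles: there is one region if and only if there is one cycle. *)

Set Implicit Arguments.
Unset Strict Implicit.
Unset Printing Implicit Defensive.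

Import Order.TTheory GRing.Theory Num.Theory.

(** * Natural numbers, finite sums, sets and orbits *)

Lemma eqn_succ k : (k == k.+1 = false) * (k.+1 == k = false) *
  (k == k.+2 = false) * (k.+2 == k = false).
Proof. by do ![split]; lia. Qed.

Lemma sum_addn1 (I : finType) (x : I -> nat) :
  \sum_k (x k + 1) = \sum_k x k + #|I|.
Proof. by rewrite big_split sum1_card. Qed.

Lemma ltn_sumE (I : finType) (x y : I -> nat) : (forall k, x k <= y k) ->
  (\sum_k x k < \sum_k y k) = [exists k, x k < y k].
Proof.
move=> xy; have := leqif_sum (fun k (_ : true) => leqif_eq (xy k)).
move=> /ltn_leqif ->; rewrite negb_forall.
by apply: eq_existsb => k; rewrite ltn_neqAle xy andbT.
Qed.

Lemma hermite_identity (N a : nat) : 0 < N -> \sum_(k < N) (a + k) %/ N = a.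
Proof.
case: N => // N _; elim: a => [|a IHa].
  by rewrite big1 // => k _; rewrite divn_small // add0n.
move: IHa; rewrite big_ord_recl addn0 => IHa.
rewrite big_ord_recr /=.
have -> : (a.+1 + N) %/ N.+1 = (a %/ N.+1).+1.
  by rewrite addSnnS divnDr // divnn addn1.
rewrite addnS -[in RHS]IHa addnC; congr (_ + _).+1.
by apply: eq_bigr => i _; rewrite /bump /= addSnnS.
Qed.

Lemma card_mem_seq (T : finType) (S : {set T}) (s : seq T) :
  uniq s -> S =i s -> #|S| = size s.
Proof. by move=> s_uniq Ss; rewrite (eq_card Ss); apply/card_uniqP. Qed.

Lemma forall_mem_seq (T : finType) (S : {set T}) (s : seq T) (P : pred T) :
  S =i s -> [forall e in S, P e] = all P s.
Proof.
move=> Ss; apply/'forall_implyP/allP => SP e; first by rewrite -Ss; exact: SP.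
by rewrite Ss; exact: SP.
Qed.

Lemma orbit_eventually_cycle (T : finType) (f : T -> T) (x : T) :
  exists k, fcycle f (orbit f (iter k f x)).
Proof.
have /trajectP[k lt_k loop] := looping_order f x; exists k.
apply/(orbitPcycle 0 3).
exists (fingraph.order f x - k).-1.
by rewrite prednK ?subn_gt0 // -iterD subnK // ltnW.
Qed.

Section NatDifferences.
Variable R : numDomainType.
Local Open Scope ring_scope.

Lemma natrB_eq01 (a c : nat) : (a <= c <= a + 1)%N ->
  (c%:R - a%:R == 0 :> R) = (c < a + 1)%N /\
  (c%:R - a%:R == 1 :> R) = (a < c)%N.
Proof.
move=> ac; rewrite subr_eq0 subr_eq nat1r !eqr_nat; lia.
Qed.

Lemma natrB01 (a c : nat) : (a <= c <= a + 1)%N ->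
  (c%:R - a%:R : R) = 0 \/ (c%:R - a%:R : R) = 1.
Proof.
move=> ac; have [->|->] : c = a \/ c = (1 + a)%N by lia.
  by left; rewrite subrr.
by right; rewrite natrD addrK.
Qed.

End NatDifferences.

(** * Alternating lines and corner sums *)

Section PrefixSums.
Variables (V : zmodType) (n : nat).
Implicit Type a : 'I_n -> V.
Local Open Scope ring_scope.

Definition prefix_sum a (m : nat) : V := \sum_(k < n | (k < m)%N) a k.

Lemma prefix_sum0 a : prefix_sum a 0 = 0.
Proof. exact: big_pred0. Qed.

Lemma prefix_sumS a (k : 'I_n) : prefix_sum a k.+1 = prefix_sum a k + a k.
Proof.
rewrite /prefix_sum (bigD1 k) //= addrC; congr (_ + _); apply: eq_bigl => l.
by rewrite -val_eqE /= ltnS; lia.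
Qed.

Lemma prefix_sum_all a m : (n <= m)%N -> prefix_sum a m = \sum_k a k.
Proof. by move=> nm; apply: eq_bigl => k; rewrite (leq_trans (ltn_ord k)). Qed.

Lemma suffix_sum a m :
  \sum_(k < n | (m <= k)%N) a k = \sum_k a k - prefix_sum a m.
Proof.
rewrite [in RHS](bigID (fun k : 'I_n => (k < m)%N)) /= addrAC subrr add0r.
by apply: eq_bigl => k; rewrite -leqNgt.
Qed.

Lemma prefix_sum_telescope (s : nat -> V) m : (m <= n)%N ->
  prefix_sum (fun k => s k.+1 - s k) m = s m - s 0%N.
Proof.
move=> mn; rewrite -(telescope_sumr s (leq0n m)) big_mkord.
by rewrite (big_ord_widen _ (fun k => s k.+1 - s k) mn).
Qed.

End PrefixSums.

Section AlternatingLines.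
Variables (R : nzRingType) (n : nat).
Implicit Type a : 'I_n -> R.
Local Open Scope ring_scope.

Lemma prefix_sum1 m : prefix_sum (fun _ : 'I_n => 1 : R) m = (minn n m)%:R.
Proof.
have [nm|/ltnW mn] := leqP n m.
  by rewrite prefix_sum_all ?sumr_const ?card_ord.
by rewrite /prefix_sum -(big_ord_widen _ (fun=> 1)) // sumr_const card_ord.
Qed.

Definition alternating a := forall j k : 'I_n, (j < k)%N ->
  a j != 0 -> a k != 0 -> (forall l : 'I_n, (j < l < k)%N -> a l = 0) ->
  a k = - a j.

Definition asm_line a :=
  [/\ forall k, [\/ a k = 0, a k = 1 | a k = -1], \sum_k a k = 1
    & alternating a].

Lemma alternating_segment_sum a m (j : 'I_n) :
  alternating a -> a j != 0 -> (j < m)%N ->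
  let s := \sum_(k < n | (j <= k < m)%N) a k in s = 0 \/ s = a j.
Proof.
move=> alt_a; have [N] := ubnP (n - j); elim: N j => // N IHN j jN aj jm.
pose later (k : 'I_n) := [&& (j < k)%N, (k < m)%N & a k != 0].
have first_term : \sum_(k < n | (j <= k < m)%N) a k =
    a j + \sum_(k < n | (j < k < m)%N) a k.
  rewrite (bigD1 j) /= ?leqnn //; congr (_ + _); apply: eq_bigl => k.
  by rewrite -val_eqE /=; lia.
have [k0 /= k0P|no_later] := pickP later; last first.
  right; rewrite first_term big1 ?addr0 // => k /andP[jk km].
  by apply/eqP/negbFE; have := no_later k; rewrite /later jk km.
case: (@arg_minnP _ k0 later val k0P) => k /and3P[jk km ak] k_min.
have gap (l : 'I_n) : (j < l < k)%N -> a l = 0.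
  move=> /andP[jl lk]; apply/eqP; apply: contraLR lk => al.
  rewrite -leqNgt; have [ml|lm] := leqP m l;
    first exact: leq_trans (ltnW km) ml.
  by apply: k_min; rewrite /later jl lm.
have -> : a j = - a k by rewrite (alt_a j k) ?opprK.
rewrite first_term (bigID (fun l : 'I_n => (k <= l)%N)) /=.
rewrite [X in _ + (_ + X)]big1 ?addr0 => [|l]; last first.
  by rewrite -ltnNge => ?; apply: gap; lia.
rewrite (eq_bigl (fun l : 'I_n => (k <= l < m)%N)) => [|l]; last by lia.
have [|//|//|->|->] := IHN k; first by have := ltn_ord k; lia.
  by right; rewrite addr0 (alt_a j k) ?opprK.
by left; rewrite (alt_a j k) // subrr.
Qed.

Lemma asm_line_prefix_sum a m :
  asm_line a -> prefix_sum a m = 0 \/ prefix_sum a m = 1.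
Proof.
move=> [_ a1 alt_a]; have [k0 ak0|a0] := pickP (fun k => a k != 0); last first.
  by left; apply: big1 => k _; exact/eqP/negbFE/a0.
case: (@arg_minnP _ k0 (fun k => a k != 0) val ak0) => j aj j_min.
have from_j l : prefix_sum a l = \sum_(k < n | (j <= k < l)%N) a k.
  rewrite /prefix_sum (bigID (fun k : 'I_n => (j <= k)%N)) /= addrC big1 ?add0r.
    by apply: eq_bigl => k; rewrite andbC.
  by move=> k /andP[_ kj]; apply/eqP; apply: contraNT kj; exact: j_min.
have := alternating_segment_sum alt_a aj (ltn_ord j).
rewrite -from_j prefix_sum_all // a1 => -[/eqP|aj1]; first by rewrite oner_eq0.
have [mj|jm] := leqP m j; first by left; rewrite from_j big1 // => k; lia.
by rewrite from_j aj1; exact: alternating_segment_sum.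
Qed.

Lemma prefix_sum_asm_line a : \sum_k a k = 1 ->
  (forall m, (m <= n)%N -> prefix_sum a m = 0 \/ prefix_sum a m = 1) ->
  asm_line a.
Proof.
move=> a1 a01; have a_lt (k : 'I_n) := a01 k (ltnW (ltn_ord k)).
have aE k : a k = prefix_sum a k.+1 - prefix_sum a k.
  by rewrite prefix_sumS addrAC subrr add0r.
split=> // [k|j k jk aj ak a_gap].
  rewrite aE; have [->|->] := a01 k.+1 (ltn_ord k); have [->|->] := a_lt k;
    rewrite ?subrr ?subr0 ?sub0r;
    by [constructor 1|constructor 2|constructor 3].
have flat : prefix_sum a k = prefix_sum a j.+1.
  rewrite /prefix_sum (bigID (fun l : 'I_n => (l <= j)%N)) /= addrC.
  rewrite big1 ?add0r.
    by apply: eq_bigl => l; lia.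
  by move=> l l_gap; apply: a_gap; lia.
move: aj ak; rewrite !aE flat.
have [->|->] := a01 j.+1 (ltn_ord j); have [->|->] := a01 k.+1 (ltn_ord k);
have [->|->] := a_lt j; by rewrite ?subrr ?eqxx // ?subr0 ?sub0r ?opprK.
Qed.

End AlternatingLines.

Section CornerSums.
Variables (V : zmodType) (n : nat).
Implicit Types (A : 'M[V]_n) (f : nat -> nat -> V).
Local Open Scope ring_scope.

Definition corner_sum A i j : V :=
  prefix_sum (fun k => prefix_sum (A k) j) i.

Definition mixed_diff f : 'M[V]_n :=
  \matrix_(i < n, j < n) (f i.+1 j.+1 - f i j.+1 - (f i.+1 j - f i j)).

Lemma corner_sumC A i j :
  corner_sum A i j = prefix_sum (fun l => prefix_sum (A^~ l) i) j.
Proof. exact: exchange_big. Qed.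

Lemma corner_sum0l A j : corner_sum A 0 j = 0.
Proof. exact: prefix_sum0. Qed.

Lemma corner_sum0r A i : corner_sum A i 0 = 0.
Proof. by rewrite corner_sumC prefix_sum0. Qed.

Lemma corner_sum_row A (i : 'I_n) j :
  corner_sum A i.+1 j - corner_sum A i j = prefix_sum (A i) j.
Proof. by rewrite /corner_sum prefix_sumS addrAC subrr add0r. Qed.

Lemma corner_sum_col A i (j : 'I_n) :
  corner_sum A i j.+1 - corner_sum A i j = prefix_sum (A^~ j) i.
Proof. by rewrite !corner_sumC prefix_sumS addrAC subrr add0r. Qed.

Definition jump f (b : bool) i j : V := f (i + b)%N (j + ~~ b)%N - f i j.

Lemma jump_corner_row A (i : 'I_n) j :
  jump (corner_sum A) true i j = prefix_sum (A i) j.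
Proof. by rewrite /jump addn1 addn0 corner_sum_row. Qed.

Lemma jump_corner_col A i (j : 'I_n) :
  jump (corner_sum A) false i j = prefix_sum (A^~ j) i.
Proof. by rewrite /jump addn1 addn0 corner_sum_col. Qed.

Lemma corner_sumK A : mixed_diff (corner_sum A) = A.
Proof.
apply/matrixP => i j; rewrite mxE !corner_sum_row prefix_sumS.
by rewrite addrAC subrr add0r.
Qed.

Lemma mixed_diffK f i j : (forall j, f 0%N j = 0) -> (forall i, f i 0%N = 0) ->
  (i <= n)%N -> (j <= n)%N -> corner_sum (mixed_diff f) i j = f i j.
Proof.
move=> f0l f0r i_n jn; rewrite -[RHS]subr0 -(f0l j).
rewrite -(prefix_sum_telescope (f^~ j) i_n); apply: eq_bigr => k _.
have -> : f k.+1 j - f k j = (f k.+1 j - f k j) - (f k.+1 0%N - f k 0%N).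
  by rewrite !f0r !subr0.
rewrite -(prefix_sum_telescope (fun l => f k.+1 l - f k l) jn).
by apply: eq_bigr => l _; rewrite mxE.
Qed.

End CornerSums.

(** * Height functions *)

Section Heights.
Variable n : nat.
Implicit Types h H : nat -> nat -> nat.

(* Corner sums sit at the positions (i, j), (i, j) being the centre of the unit
   square whose upper left corner is the vertex (i, j).  The step from (i, j) to
   (i + b, j + ~~ b) is downward if [b] holds and to the right otherwise. *)
Definition inner i j : bool := (0 < i < n) && (0 < j < n).

(* For [N = 1] these are the corner sums of the alternating sign matrices; in
   general, those of the sums of [N] of them.  The first condition says that all
   lines of the matrix sum to [N]. *)
Record height (N : nat) H : Prop := Height {
  height_outer : forall i j, ~~ inner i j -> H i j = N * minn n (minn i j);
  height_step : forall (b : bool) i j, i + b <= n -> j + ~~ b <= n ->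
    H i j <= H (i + b) (j + ~~ b) <= H i j + N }.

Lemma height0l N H j : height N H -> H 0 j = 0.
Proof.
by move=> H_height; rewrite (height_outer H_height) // min0n minn0 muln0.
Qed.

Lemma height0r N H i : height N H -> H i 0 = 0.
Proof.
move=> H_height; rewrite (height_outer H_height) ?minn0 ?muln0 //.
by rewrite /inner ltnn andbF.
Qed.

Lemma height_down N H i j : height N H -> i < n -> j <= n ->
  H i j <= H i.+1 j <= H i j + N.
Proof.
by move=> H_height; have := @height_step _ _ H_height true i j;
  rewrite addn1 addn0.
Qed.

Lemma height_right N H i j : height N H -> i <= n -> j < n ->
  H i j <= H i j.+1 <= H i j + N.
Proof.
by move=> H_height; have := @height_step _ _ H_height false i j;
  rewrite addn1 addn0.
Qed.

Lemma height0E H i j : height 0 H -> H i j = 0.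
Proof.
move=> H_height; have [|/(height_outer H_height)->] := boolP (inner i j);
  last exact: mul0n.
move=> /andP[/andP[_ i_n] /andP[_ jn]].
elim: i i_n => [|i IHi] i_n; first exact: height0l H_height.
have := height_down (i := i) (j := j) H_height; rewrite IHi; lia.
Qed.

Lemma height_sum (I : finType) (h : I -> nat -> nat -> nat) :
  (forall k, height 1 (h k)) -> height #|I| (fun i j => \sum_k h k i j).
Proof.
move=> h_height; split=> [i j ij|b i j ib jb].
  under eq_bigr do rewrite (height_outer (h_height _) ij) mul1n.
  by rewrite sum_nat_const.
have step k := height_step (h_height k) ib jb; apply/andP; split.
  by apply: leq_sum => k _; case/andP: (step k).
by rewrite -sum_addn1; apply: leq_sum => k _; case/andP: (step k).
Qed.

Definition rounding (N k : nat) H i j : nat := (H i j + k) %/ N.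

Lemma height_rounding N k H : k < N -> height N H -> height 1 (rounding N k H).
Proof.
move=> kN H_height; have N_gt0 : 0 < N by apply: leq_trans kN.
split=> [i j ij|b i j ib jb].
  by rewrite /rounding (height_outer H_height ij) mulnC divnMDl // divn_small
    ?addn0 ?mul1n.
have /andP[up dn] := height_step H_height ib jb.
rewrite /rounding leq_div2r ?leq_add2r //=.
have -> : (H i j + k) %/ N + 1 = (H i j + k + N) %/ N.
  by rewrite (divnDr _ (dvdnn N)) divnn N_gt0.
by rewrite leq_div2r // addnAC leq_add2r.
Qed.

Lemma sum_rounding N H i j :
  height N H -> \sum_(k < N) rounding N k H i j = H i j.
Proof.
case: N => [|N] H_height; last exact: hermite_identity.
by rewrite big_ord0 (height0E _ _ H_height).
Qed.

End Heights.

(** * Segments and grids of height functions *)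

Section Segments.
Variable n : nat.
Local Notation vtx := (vtx n).

Lemma vtx_val (v : vertex n) : vtx v.1 v.2 = v.
Proof. by case: v => i j; rewrite /Defs.vtx !inord_val. Qed.

Lemma eq_vtx i j i' j' : i <= n.+1 -> j <= n.+1 -> i' <= n.+1 -> j' <= n.+1 ->
  (vtx i j == vtx i' j') = (i == i') && (j == j').
Proof. by move=> ? ? ? ?; rewrite xpair_eqE -!val_eqE /= !inordK. Qed.

Lemma internal_vtx i j : internal (vtx i j) = (0 < i <= n) && (0 < j <= n).
Proof.
have inordE k : (0 < (inord k : 'I_n.+2) <= n) = (0 < k <= n).
  have [k_n|n_k] := leqP k n.+1; first by rewrite inordK.
  by rewrite /inord /insubd insubF /=; lia.
by rewrite /internal /= !inordE.
Qed.

Lemma internal_vtxP (v : vertex n) : internal v ->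
  exists i j, [/\ i < n, j < n & v = vtx i.+1 j.+1].
Proof.
move=> /andP[/andP[i0 i_n] /andP[j0 jn]]; exists v.1.-1, v.2.-1.
by rewrite !prednK // vtx_val.
Qed.

Section Directions.
Variables i j i' j' : nat.
Hypotheses (i_n : i <= n.+1) (j_n : j <= n.+1).
Hypotheses (i'_n : i' <= n.+1) (j'_n : j' <= n.+1).

Lemma rightward_vtx :
  rightward (vtx i j, vtx i' j') = (i' == i) && (j' == j.+1).
Proof. by rewrite /rightward -val_eqE /= !inordK. Qed.

Lemma leftward_vtx :
  leftward (vtx i j, vtx i' j') = (i' == i) && (j == j'.+1).
Proof. by rewrite /leftward -val_eqE /= !inordK. Qed.

Lemma downward_vtx :
  downward (vtx i j, vtx i' j') = (j' == j) && (i' == i.+1).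
Proof. by rewrite /downward -val_eqE /= !inordK. Qed.

Lemma upward_vtx :
  upward (vtx i j, vtx i' j') = (j' == j) && (i == i'.+1).
Proof. by rewrite /upward -val_eqE /= !inordK. Qed.

End Directions.

Definition direction_vtx :=
  (rightward_vtx, leftward_vtx, downward_vtx, upward_vtx).

(* The edge directed rightward if [b] holds and downward otherwise that
   separates the positions (i, j) and (i + b, j + ~~ b). *)
Definition segment (b : bool) i j : edge n :=
  (vtx (i + b) (j + ~~ b), vtx i.+1 j.+1).

Definition reversed (e : edge n) : edge n := (e.2, e.1).

Variant complete_edge_spec : edge n -> Prop :=
| CompleteSegment (b : bool) i j of i + b <= n & j + ~~ b <= n :
    complete_edge_spec (segment b i j)
| CompleteReversed (b : bool) i j of i + b <= n & j + ~~ b <= n :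
    complete_edge_spec (reversed (segment b i j)).

Lemma complete_edgeP e : e \in complete_flow_grid n -> complete_edge_spec e.
Proof.
case: e => v w; rewrite inE /= -(vtx_val v) -(vtx_val w) internal_vtx.
have := ltn_ord w.1; have := ltn_ord w.2.
move: (nat_of_ord v.1) (nat_of_ord v.2) (nat_of_ord w.1) (nat_of_ord w.2).
move=> i j i' j' j'_n i'_n /andP[/andP[/andP[i0 i_n] /andP[j0 jn]]].
rewrite /horizontal /vertical !direction_vtx; try lia.
case/orP => /orP[] /andP[/eqP Ei /eqP Ej]; subst.
- case: i i0 {i'_n} i_n => // i _ i_n.
  have := @CompleteSegment true i j; rewrite /segment addn0 addn1; apply=> //;
    lia.
- case: i i0 {i'_n} i_n => // i _ i_n.
  have := @CompleteReversed true i j'; rewrite /reversed /segment /= addn0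
    addn1; apply=> //; lia.
- case: j j0 {j'_n} jn => // j _ jn.
  have := @CompleteSegment false i j; rewrite /segment addn0 addn1; apply=> //;
    lia.
- case: j j0 {j'_n} jn => // j _ jn.
  have := @CompleteReversed false i' j; rewrite /reversed /segment /= addn0
    addn1; apply=> //; lia.
Qed.

Section Membership.
Variables (b : bool) (i j : nat).
Hypotheses (ib : i + b <= n) (jb : j + ~~ b <= n).

Lemma segment_complete :
  (segment b i j \in complete_flow_grid n) = (0 < i + b) && (0 < j + ~~ b).
Proof.
rewrite inE /= internal_vtx /horizontal /vertical !direction_vtx; lia.
Qed.

Lemma reversed_segment_complete :
  (reversed (segment b i j) \in complete_flow_grid n) = (i < n) && (j < n).
Proof.
rewrite inE /= internal_vtx /horizontal /vertical !direction_vtx; lia.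
Qed.

End Membership.

End Segments.

Section HeightGrids.
Variable n : nat.
Implicit Types H : nat -> nat -> nat.
Local Notation height := (height n).

(* For an edge (v, w) directed rightward or downward, (v.1, v.2) is the position
   on the far side and (w.1 - 1, w.2 - 1) the one on the near side. *)
Definition height_grid (N : nat) H : grid n :=
  [set e in complete_flow_grid n |
    if rightward e || downward e then H e.2.1.-1 e.2.2.-1 < H e.1.1 e.1.2
    else H e.2.1 e.2.2 < H e.1.1.-1 e.1.2.-1 + N]%SET.

Section Membership.
Variables (N : nat) (H : nat -> nat -> nat) (b : bool) (i j : nat).
Hypotheses (H_height : height N H) (ib : i + b <= n) (jb : j + ~~ b <= n).

Lemma segment_height_grid :
  (segment n b i j \in height_grid N H) = (H i j < H (i + b) (j + ~~ b)).
Proof.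
rewrite inE segment_complete // !direction_vtx; try lia.
rewrite /= !inordK; try lia.
rewrite ifT; last by case: b ib jb; lia.
apply: andb_idl; apply: contraTT => boundary.
rewrite -leqNgt (height_outer H_height); last by rewrite /inner; lia.
have -> : minn n (minn (i + b) (j + ~~ b)) = 0 by lia.
by rewrite muln0.
Qed.

Lemma reversed_segment_height_grid :
  (reversed (segment n b i j) \in height_grid N H) =
  (H (i + b) (j + ~~ b) < H i j + N).
Proof.
rewrite inE reversed_segment_complete // !direction_vtx; try lia.
rewrite /= !inordK; try lia.
rewrite ifF; last by case: b ib jb; lia.
apply: andb_idl; apply: contraTT => boundary; rewrite -leqNgt.
have near_out : ~~ inner n i j by rewrite /inner; lia.
have far_out : ~~ inner n (i + b) (j + ~~ b) by rewrite /inner; lia.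
rewrite (height_outer H_height near_out) (height_outer H_height far_out).
have -> : minn n (minn (i + b) (j + ~~ b)) = (minn n (minn i j)).+1.
  by case: b ib jb {near_out far_out} boundary => /=; lia.
by rewrite mulnS addnC.
Qed.

End Membership.

Lemma height_grid_complete N H : height_grid N H \subset complete_flow_grid n.
Proof. by apply/fintype.subsetP => e; rewrite inE => /andP[]. Qed.

Lemma sub_grid_segments (G G' : grid n) : G \subset complete_flow_grid n ->
  (forall (b : bool) i j, i + b <= n -> j + ~~ b <= n ->
     (segment n b i j \in G -> segment n b i j \in G') /\
     (reversed (segment n b i j) \in G -> reversed (segment n b i j) \in G')) ->
  G \subset G'.
Proof.
move=> /fintype.subsetP GC GG'; apply/fintype.subsetP => e eG.
by case/complete_edgeP: (GC e eG) (eG) => b i j ib jb; case: (GG' b i j ib jb).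
Qed.

Lemma eq_grid_segments (G G' : grid n) :
  G \subset complete_flow_grid n -> G' \subset complete_flow_grid n ->
  (forall (b : bool) i j, i + b <= n -> j + ~~ b <= n ->
     (segment n b i j \in G) = (segment n b i j \in G') /\
     (reversed (segment n b i j) \in G) =
       (reversed (segment n b i j) \in G')) ->
  G =i G'.
Proof.
move=> GC G'C GG'; apply/subset_eqP/andP.
by split; apply: sub_grid_segments => // b i j ib jb;
  have [-> ->] := GG' b i j ib jb.
Qed.

Lemma rounding_grid N k H : k < N -> height N H ->
  height_grid 1 (rounding N k H) \subset height_grid N H.
Proof.
move=> kN H_height; have N_gt0 : 0 < N by apply: leq_trans kN.
apply: sub_grid_segments (height_grid_complete _ _) _ => b i j ib jb.
have round_height := height_rounding kN H_height.
rewrite !segment_height_grid // !reversed_segment_height_grid // /rounding.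
split; apply: contraTT; rewrite -!leqNgt => le_H.
  by apply: leq_div2r; lia.
have -> : (H i j + k) %/ N + 1 = (H i j + N + k) %/ N.
  by rewrite addnAC (divnDr _ (dvdnn N)) divnn N_gt0.
by rewrite leq_div2r ?leq_add2r.
Qed.

Lemma height_grid_sum (I : finType) (h : I -> nat -> nat -> nat) :
  (forall k, height 1 (h k)) ->
  height_grid #|I| (fun i j => \sum_k h k i j) =
    (\bigcup_k height_grid 1 (h k))%SET.
Proof.
move=> h_height; have sum_height := height_sum h_height.
have bigcupC : (\bigcup_k height_grid 1 (h k) \subset complete_flow_grid n)%SET.
  by apply/finset.bigcupsP => k _; exact: height_grid_complete.
have mem_bigcup e : (e \in \bigcup_k height_grid 1 (h k))%SET =
    [exists k, e \in height_grid 1 (h k)].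
  by apply/finset.bigcupP/existsP => -[k]; exists k.
apply/setP; apply: eq_grid_segments => // [|b i j ib jb].
  exact: height_grid_complete.
have step k := height_step (h_height k) ib jb.
rewrite !mem_bigcup segment_height_grid // reversed_segment_height_grid //.
rewrite -sum_addn1 !ltn_sumE => [|k|k]; try by case/andP: (step k).
split; apply: eq_existsb => k.
  by rewrite segment_height_grid.
by rewrite reversed_segment_height_grid.
Qed.

Lemma height_sub N H h : height N H -> height 1 h ->
  height_grid 1 h \subset height_grid N H ->
  height N.-1 (fun i j => H i j - h i j) /\
  forall i j, i <= n -> j <= n -> h i j <= H i j.
Proof.
move=> H_height h_height /fintype.subsetP hG.
have step (b : bool) i j : i + b <= n -> j + ~~ b <= n ->
    H i j + h (i + b) (j + ~~ b) <= H (i + b) (j + ~~ b) + h i j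
      < H i j + h (i + b) (j + ~~ b) + N.
  move=> ib jb; have := height_step h_height ib jb.
  have := height_step H_height ib jb.
  have := hG (segment n b i j); have := hG (reversed (segment n b i j)).
  rewrite !segment_height_grid // !reversed_segment_height_grid //; lia.
have le_hH i j : i <= n -> j <= n -> h i j <= H i j.
  elim: i => [|i IHi] i_n jn; first by rewrite (height0l _ h_height).
  have := IHi (ltnW i_n) jn; have := step true i j; rewrite /= addn0 addn1; lia.
split=> //; split=> [i j ij|b i j ib jb].
  rewrite (height_outer H_height) // (height_outer h_height) //.
  by rewrite -subn1 mulnBl.
have := le_hH i j; have := le_hH (i + b) (j + ~~ b).
have := step b i j ib jb; lia.
Qed.

End HeightGrids.

(** * Flow grids of alternating sign matrices *)

Section FlowGridOfMatrix.
Variables (R : realType) (n : nat).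
Implicit Type A : 'M[R]_n.
Local Open Scope ring_scope.

Lemma mem_flow_grid A (i j : 'I_n) w : let v := vtx n i.+1 j.+1 in
  ((v, w) \in flow_grid_of A) =
  ((v, w) \in complete_flow_grid n) && (partial_sum A i j (v, w) == 1).
Proof.
rewrite /= inE; congr (_ && _); apply/existsP/idP => [[i' /existsP[j']]|v1].
  have lt_n (k : 'I_n) : (k.+1 <= n.+1)%N by exact: ltnW (ltn_ord k).
  rewrite /= eq_vtx // => /andP[/andP[/eqP[ii'] /eqP[jj']]].
  by rewrite (ord_inj ii') (ord_inj jj').
by exists i; apply/existsP; exists j; rewrite eqxx.
Qed.

Section UnitLineSums.
Variables (A : 'M[R]_n) (b : bool) (i j : nat).
Hypotheses (row_sum : forall i, \sum_j A i j = 1)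
  (col_sum : forall j, \sum_i A i j = 1).
Hypotheses (ib : (i + b <= n)%N) (jb : (j + ~~ b <= n)%N).

Lemma segment_flow_grid :
  (segment n b i j \in flow_grid_of A) =
  (segment n b i j \in complete_flow_grid n) &&
    (jump (corner_sum A) b i j == 1).
Proof.
have [sC|] /= := boolP (_ \in complete_flow_grid n); last first.
  by apply: contraNF; rewrite inE => /andP[].
move: sC (sC); rewrite {1}segment_complete // /segment => tail_pos.
case: b ib jb tail_pos => /= [i_n jn|i_n jn];
  rewrite addn0 addn1 => tail_pos sC.
  case: j jn tail_pos sC => [|l] jn tail_pos; first by lia.
  rewrite addn1 in i_n; rewrite addn0 in jn.
  rewrite (mem_flow_grid A (Ordinal i_n) (Ordinal jn)) => -> /=.
  rewrite (jump_corner_row A (Ordinal i_n)).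
  by rewrite /partial_sum !direction_vtx ?eqxx //; lia.
case: i i_n tail_pos sC => [|k] i_n tail_pos; first by lia.
rewrite addn0 in i_n; rewrite addn1 in jn.
rewrite (mem_flow_grid A (Ordinal i_n) (Ordinal jn)) => -> /=.
rewrite (jump_corner_col A _ (Ordinal jn)).
rewrite /partial_sum !direction_vtx; try lia.
by rewrite !eqxx /= ifF ?ifF //; lia.
Qed.

Lemma reversed_segment_flow_grid :
  (reversed (segment n b i j) \in flow_grid_of A) =
  (reversed (segment n b i j) \in complete_flow_grid n) &&
  (jump (corner_sum A) b i j == 0).
Proof.
have [sC|] /= := boolP (_ \in complete_flow_grid n); last first.
  by apply: contraNF; rewrite inE => /andP[].
move: (sC); rewrite reversed_segment_complete // => /andP[i_n jn].
have unit_sub (x : R) : (1 - x == 1) = (x == 0).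
  by rewrite -[RHS]oppr_eq0 -subr_eq0 addrAC subrr add0r.
rewrite (mem_flow_grid A (Ordinal i_n) (Ordinal jn)) sC -unit_sub /=.
case: b sC ib jb => /= sC ib' jb'; rewrite /partial_sum !direction_vtx; try lia.
  rewrite addn0 addn1 !eqxx (jump_corner_row A (Ordinal i_n)) /= ifF;
    last by lia.
  by rewrite suffix_sum row_sum.
rewrite addn0 addn1 !eqxx (jump_corner_col A _ (Ordinal jn)) /= !ifF; try lia.
by rewrite (suffix_sum (A^~ _)) col_sum.
Qed.

End UnitLineSums.

Lemma flow_grid_complete A : flow_grid_of A \subset complete_flow_grid n.
Proof. by apply/fintype.subsetP => e; rewrite inE => /andP[]. Qed.

End FlowGridOfMatrix.

Section HeightMatrices.
Variables (R : realType) (n : nat).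
Implicit Types (A : 'M[R]_n) (h H : nat -> nat -> nat).
Local Open Scope ring_scope.

Definition asm_of H : 'M[R]_n := mixed_diff n (fun i j => (H i j)%:R).

Lemma corner_sum_asm_of N H i j : height n N H -> (i <= n)%N -> (j <= n)%N ->
  corner_sum (asm_of H) i j = (H i j)%:R.
Proof.
by move=> H_height; apply: mixed_diffK => k;
  rewrite ?(height0l _ H_height) ?(height0r _ H_height).
Qed.

Lemma eq_asm_of H H' :
  (forall i j, (i <= n)%N -> (j <= n)%N -> H i j = H' i j) ->
  asm_of H = asm_of H'.
Proof. by move=> HH'; apply/matrixP => i j; rewrite !mxE !HH' // ltnW. Qed.

Lemma asm_ofD H H' :
  asm_of (fun i j => H i j + H' i j)%N = asm_of H + asm_of H'.
Proof. by apply/matrixP => i j; rewrite !mxE !natrD; ring. Qed.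

Lemma asm_of_sum (I : finType) (H : I -> nat -> nat -> nat) :
  asm_of (fun i j => \sum_k H k i j)%N = \sum_k asm_of (H k).
Proof.
apply/matrixP => i j; rewrite mxE summxE !natr_sum -!sumrB.
by apply: eq_bigr => k _; rewrite mxE.
Qed.

Lemma ASM_lines A : is_ASM A <->
  (forall i, asm_line (A i)) /\ (forall j, asm_line (A^~ j)).
Proof.
split=> [[A01 row1 col1 row_alt col_alt]|[rowA colA]].
  split=> k; split=> //.
  - exact: row_alt.
  - exact: col_alt.
split=> k.
- by case: (rowA k).
- by case: (rowA k).
- by case: (colA k).
- by case: (rowA k).
- by case: (colA k).
Qed.

Lemma asm_of_ASM h : height n 1 h -> is_ASM (asm_of h).
Proof.
move=> h_height; have row_prefix (i : 'I_n) m : (m <= n)%N ->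
    prefix_sum (asm_of h i) m = (h i.+1 m)%:R - (h i m)%:R.
  move=> mn; rewrite -jump_corner_row /jump addn0 addn1.
  by rewrite !(corner_sum_asm_of h_height) // ltnW.
have col_prefix (j : 'I_n) m : (m <= n)%N ->
    prefix_sum ((asm_of h)^~ j) m = (h m j.+1)%:R - (h m j)%:R.
  move=> mn; rewrite -jump_corner_col /jump addn0 addn1.
  by rewrite !(corner_sum_asm_of h_height) // ltnW.
have border k : (k <= n)%N -> (h k n = k) * (h n k = k).
  by move=> kn; split; rewrite (height_outer h_height) /inner; lia.
have border_step k : (k < n)%N -> (k.+1%:R - k%:R : R) = 1.
  by rewrite -addn1 natrD addrAC subrr add0r.
apply/ASM_lines; split=> k; apply: prefix_sum_asm_line => [|m mn].
- by rewrite -(prefix_sum_all _ (leqnn n)) row_prefix // !border ?border_step //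
    ltnW.
- by rewrite row_prefix //; apply: natrB01; exact: height_down h_height _ mn.
- by rewrite -(prefix_sum_all _ (leqnn n)) col_prefix // !border ?border_step //
    ltnW.
- by rewrite col_prefix //; apply: natrB01; exact: height_right h_height mn _.
Qed.

Lemma ASM_jump A (b : bool) i j :
  is_ASM A -> (i + b <= n)%N -> (j + ~~ b <= n)%N ->
  jump (corner_sum A) b i j = 0 \/ jump (corner_sum A) b i j = 1.
Proof.
move=> /ASM_lines[rowA colA]; case: b; rewrite /= addn1 addn0 => i_n jn.
  by rewrite (jump_corner_row A (Ordinal i_n)); exact: asm_line_prefix_sum.
by rewrite (jump_corner_col A _ (Ordinal jn)); exact: asm_line_prefix_sum.
Qed.

Lemma ASM_corner_outer A i j : is_ASM A -> ~~ inner n i j ->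
  corner_sum A i j = (minn n (minn i j))%:R.
Proof.
move=> [_ row1 col1 _ _]; have [->|i0] := posnP i.
  by rewrite corner_sum0l min0n minn0.
have [->|j0] := posnP j; first by rewrite corner_sum0r !minn0.
have [ni _|i_n] := leqP n i.
  rewrite corner_sumC.
  have -> : (fun l => prefix_sum (A^~ l) i) = (fun=> 1).
    by apply/funext => l; rewrite prefix_sum_all.
  by rewrite prefix_sum1; congr _%:R; lia.
rewrite /inner i0 i_n j0 /= -leqNgt => nj; rewrite /corner_sum.
have -> : (fun k => prefix_sum (A k) j) = (fun=> 1).
  by apply/funext => k; rewrite prefix_sum_all.
by rewrite prefix_sum1; congr _%:R; lia.
Qed.

Lemma ASM_height A : is_ASM A -> exists2 h, height n 1 h & A = asm_of h.
Proof.
move=> asmA; have [rowA _] := (ASM_lines A).1 asmA.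
pose h i j := Num.truncn (corner_sum A i j).
have hE i j : (h i j)%:R = corner_sum A i j.
  rewrite truncnK // rpred_sum // => k _.
  by have [->|->] := asm_line_prefix_sum j (rowA k); rewrite ?rpred0 ?rpred1.
have natr_inj (a c : nat) : a%:R = c%:R :> R -> a = c.
  by move/eqP; rewrite eqr_nat => /eqP.
exists h; last first.
  by rewrite /asm_of -[LHS]corner_sumK; congr mixed_diff;
    apply/funext => i; apply/funext => j; rewrite hE.
split=> [i j ij|b i j ib jb].
  by apply: natr_inj; rewrite hE ASM_corner_outer // mul1n.
have := ASM_jump asmA ib jb; rewrite /jump -!hE => -[]/eqP.
  by rewrite subr_eq0 eqr_nat; lia.
by rewrite subr_eq nat1r eqr_nat; lia.
Qed.

Lemma flow_grid_of_asm h : height n 1 h ->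
  flow_grid_of (asm_of h) = height_grid n 1 h.
Proof.
move=> h_height; have [_ row1 col1 _ _] := asm_of_ASM h_height; apply/setP.
apply: eq_grid_segments => [||b i j ib jb].
- exact: flow_grid_complete.
- exact: height_grid_complete.
have [jump0 jump1] := natrB_eq01 R (height_step h_height ib jb).
rewrite segment_flow_grid // reversed_segment_flow_grid // /jump.
rewrite !(corner_sum_asm_of h_height) ?jump0 ?jump1 //; try lia.
rewrite -(segment_height_grid h_height) //.
rewrite -(reversed_segment_height_grid h_height) //.
by split; apply: andb_idl; apply/fintype.subsetP/height_grid_complete.
Qed.

End HeightMatrices.

(** * Simple flow grids *)

Section VertexCondition.
Variable n : nat.
Implicit Type G : grid n.
Local Notation vtx := (vtx n).
Local Notation segment := (segment n).

(* The arguments record, for each of two opposite neighbours, whether the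
   outgoing and the incoming edge are present. *)
Definition parallel_at (o1 i1 o2 i2 : bool) : bool :=
  (o1 + i1 + o2 + i2 == 2) && (~~ (i1 || o2) || ~~ (o1 || i2)).

Definition simple_at (ro ri lo li dO di uo ui : bool) : bool :=
  (ro + ri + lo + li + dO + di + uo + ui == 4) &&
  [|| ~~ [|| ro, lo, dO | uo], ~~ [|| ri, li, di | ui]
    | parallel_at ro ri lo li && parallel_at dO di uo ui].

Lemma simple_atE ro ri lo li dO di uo ui :
  simple_at ro ri lo li dO di uo ui =
  [&& ri == ~~ ro, lo == ~~ li, di == ~~ dO, uo == ~~ ui & ro + ui == dO + li].
Proof. by case: ro ri lo li dO di uo ui => [] [] [] [] [] [] [] []. Qed.

(* Right, left, down and up, each outgoing first *)
Definition edges_at i j : seq (edge n) :=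
  [:: segment true i j.+1; reversed (segment true i j.+1);
      reversed (segment true i j); segment true i j;
      segment false i.+1 j; reversed (segment false i.+1 j);
      reversed (segment false i j); segment false i j].

Lemma eq_edge (v w v' w' : vertex n) :
  ((v, w) == (v', w') :> edge n) = (v == v') && (w == w').
Proof. exact: xpair_eqE. Qed.

Lemma uniq_edges_at i j : i < n -> j < n -> uniq (edges_at i j).
Proof.
move=> i_n jn; rewrite /= !inE /reversed /segment /= !addn0 !addn1 !eq_edge.
by rewrite !eq_vtx; lia.
Qed.

Lemma mem_incident G i j : i < n -> j < n -> G \subset complete_flow_grid n ->
  incident G (vtx i.+1 j.+1) =i [seq e <- edges_at i j | e \in G].
Proof.
move=> i_n jn /fintype.subsetP GC e; rewrite inE mem_filter.
have [eG|//] /= := boolP (e \in G).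
apply/idP/idP => [|]; last first.
  by rewrite !inE; do 7?[case/orP]; move/eqP->;
    rewrite /= !addn0 !addn1 eqxx ?orbT.
case/complete_edgeP: (GC e eG) => -[] k l /=;
  rewrite ?addn0 ?addn1 => kb lb /orP[];
  rewrite eq_vtx ?eqSS; try lia; case/andP => /eqP ? /eqP ?; subst;
  by rewrite !inE eqxx ?orbT.
Qed.

Lemma simple_vertexE G i j : i < n -> j < n -> G \subset complete_flow_grid n ->
  let v := vtx i.+1 j.+1 in
  (#|incident G v| == 4) &&
  [|| [forall e in incident G v, e.2 == v],
      [forall e in incident G v, e.1 == v]
    | two_parallel [set e in incident G v | horizontal e]%SET &&
      two_parallel [set e in incident G v | vertical e]%SET] =
  simple_at
    (segment true i j.+1 \in G) (reversed (segment true i j.+1) \in G)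
    (reversed (segment true i j) \in G) (segment true i j \in G)
    (segment false i.+1 j \in G) (reversed (segment false i.+1 j) \in G)
    (reversed (segment false i j) \in G) (segment false i j \in G).
Proof.
move=> i_n jn GC v; have inc := mem_incident i_n jn GC.
have inc_uniq := filter_uniq (mem G) (uniq_edges_at i_n jn).
have sub_inc (P : pred (edge n)) : [set e in incident G v | P e]%SET =i
    [seq e <- [seq e <- edges_at i j | e \in G] | P e].
  by move=> e; rewrite inE mem_filter inc andbC.
have sub_uniq P := filter_uniq P inc_uniq.
rewrite (card_mem_seq inc_uniq inc) !(forall_mem_seq _ inc).
rewrite /two_parallel /same_direction !(card_mem_seq (sub_uniq _) (sub_inc _)).
rewrite !(forall_mem_seq _ (sub_inc _)) !size_filter !all_filter !count_filter.
have [i0 i1 j0 j1] : [/\ i <= n.+1, i.+1 <= n.+1, j <= n.+1 & j.+1 <= n.+1].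
  by split; lia.
rewrite /edges_at /v /= /horizontal /vertical /reversed /segment /=.
rewrite !addn0 !addn1 !direction_vtx // ?eq_vtx // ?eqSS ?eqn_succ ?eqxx /=.
rewrite /simple_at /parallel_at.
by do 8![case: (_ \in G)].
Qed.

(* The last condition makes the horizontal and the vertical differences define
   the same matrix. *)
Lemma simple_flow_gridP G :
  simple_flow_grid G <->
  [/\ G \subset complete_flow_grid n,
      forall (b : bool) i j, i + b <= n -> j + ~~ b <= n ->
        (reversed (segment b i j) \in G) = (segment b i j \notin G)
    & forall i j, i < n -> j < n ->
        (segment true i j.+1 \in G) + (segment false i j \in G) =
        (segment false i.+1 j \in G) + (segment true i j \in G)].
Proof.
split=> [/andP[GC /forallP simpleG]|[GC orient balance]]; last first.
  apply/andP; split=> //; apply/forallP => v; apply/implyP.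
  move=> /internal_vtxP[i [j [i_n jn ->]]].
  rewrite simple_vertexE // simple_atE !orient; try lia.
  by rewrite !eqxx /= balance.
have at_vertex i j : i < n -> j < n ->
    [/\ forall s, s \in [:: segment true i j.+1; segment true i j;
                           segment false i.+1 j; segment false i j] ->
          (reversed s \in G) = (s \notin G)
      & (segment true i j.+1 \in G) + (segment false i j \in G) =
        (segment false i.+1 j \in G) + (segment true i j \in G)].
  move=> i_n jn; have := simpleG (vtx i.+1 j.+1); rewrite internal_vtx i_n jn.
  rewrite implyTb simple_vertexE // simple_atE.
  move=> /and5P[/eqP ri /eqP lo /eqP di /eqP uo /eqP balance]; split=> // s.
  by rewrite !inE => /or4P[] /eqP ->.
split=> // [[] i j /=|i j i_n jn]; last by case: (at_vertex i j).
  rewrite addn0 addn1 => i_n jn; have [{}jn|nj] := ltnP j n.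
    by have [-> //] := at_vertex i j i_n jn; rewrite !inE eqxx ?orbT.
  case: j jn nj => [|j] jn nj; first by lia.
  by have [-> //] := at_vertex i j i_n jn; rewrite !inE eqxx ?orbT.
rewrite addn0 addn1 => i_n jn; have [{}i_n|ni] := ltnP i n.
  by have [-> //] := at_vertex i j i_n jn; rewrite !inE eqxx ?orbT.
case: i i_n ni => [|i] i_n ni; first by lia.
by have [-> //] := at_vertex i j i_n jn; rewrite !inE eqxx ?orbT.
Qed.

End VertexCondition.

Section MatrixOfSimpleGrid.
Variables (R : realType) (n : nat) (G : grid n).
Hypothesis simpleG : simple_flow_grid G.
Local Notation segment := (segment n).
Local Open Scope ring_scope.

Definition grid_matrix : 'M[R]_n :=
  \matrix_(i, j) ((segment true i j.+1 \in G)%:R - (segment true i j \in G)%:R).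

Lemma simple_grid_complete e : e \in G -> e \in complete_flow_grid n.
Proof.
by case/simple_flow_gridP: simpleG => /fintype.subsetP GC _ _; exact: GC.
Qed.

Lemma simple_grid_first (b : bool) i j : (i + b <= n)%N -> (j + ~~ b <= n)%N ->
  (i + b == 0)%N || (j + ~~ b == 0)%N -> (segment b i j \in G) = false.
Proof.
move=> ib jb border; apply: contraTF border => /simple_grid_complete.
by rewrite segment_complete //; lia.
Qed.

Lemma simple_grid_last (b : bool) i j : (i + b <= n)%N -> (j + ~~ b <= n)%N ->
  (i == n) || (j == n) -> segment b i j \in G.
Proof.
move=> ib jb border; case/simple_flow_gridP: simpleG => _ orient _.
rewrite -[_ \in G]negbK -orient //.
apply: contraTN border => /simple_grid_complete.
by rewrite reversed_segment_complete //; lia.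
Qed.

Lemma grid_matrix_row (i : 'I_n) m : (m <= n)%N ->
  prefix_sum (grid_matrix i) m = (segment true i m \in G)%:R.
Proof.
have first0 : (segment true i 0 \in G)%:R = 0 :> R.
  by rewrite simple_grid_first ?addn1 ?addn0 ?orbT.
move=> mn; rewrite -[RHS]subr0 -[X in _ - X]first0.
rewrite -(prefix_sum_telescope (fun l => (segment true i l \in G)%:R) mn).
by apply: eq_bigr => l _; rewrite mxE.
Qed.

Lemma grid_matrix_col (j : 'I_n) m : (m <= n)%N ->
  prefix_sum (grid_matrix^~ j) m = (segment false m j \in G)%:R.
Proof.
have first0 : (segment false 0 j \in G)%:R = 0 :> R.
  by rewrite simple_grid_first ?addn1 ?addn0.
move=> mn; rewrite -[RHS]subr0 -[X in _ - X]first0.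
rewrite -(prefix_sum_telescope (fun k => (segment false k j \in G)%:R) mn).
apply: eq_bigr => k _; rewrite mxE; case/simple_flow_gridP: simpleG => _ _.
move=> /(_ k j (ltn_ord k) (ltn_ord j)) /(congr1 (fun x => x%:R : R)).
by rewrite !natrD => balance; lra.
Qed.

Lemma jump_grid_matrix (b : bool) i j : (i + b <= n)%N -> (j + ~~ b <= n)%N ->
  jump (corner_sum grid_matrix) b i j = (segment b i j \in G)%:R.
Proof.
case: b => /= i_n jn; rewrite ?addn0 ?addn1 in i_n jn.
  by rewrite (jump_corner_row _ (Ordinal i_n)) grid_matrix_row.
by rewrite (jump_corner_col _ _ (Ordinal jn)) grid_matrix_col.
Qed.

Lemma grid_matrix_ASM : is_ASM grid_matrix.
Proof.
have bool01 (x : bool) : x%:R = 0 :> R \/ x%:R = 1 :> R.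
  by case: x; [right|left].
apply/ASM_lines; split=> k; apply: prefix_sum_asm_line => [|m mn].
- rewrite -(prefix_sum_all _ (leqnn n)) grid_matrix_row //.
  by rewrite simple_grid_last ?addn1 ?addn0 ?eqxx ?orbT.
- by rewrite grid_matrix_row.
- rewrite -(prefix_sum_all _ (leqnn n)) grid_matrix_col //.
  by rewrite simple_grid_last ?addn1 ?addn0 ?eqxx.
- by rewrite grid_matrix_col.
Qed.

Lemma flow_grid_of_grid_matrix : flow_grid_of grid_matrix = G.
Proof.
have [_ row1 col1 _ _] := grid_matrix_ASM.
have [GC orient _] := (simple_flow_gridP G).1 simpleG.
apply/setP; apply: eq_grid_segments => [||b i j ib jb] //.
  exact: flow_grid_complete.
rewrite segment_flow_grid // reversed_segment_flow_grid // jump_grid_matrix //.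
rewrite pnatr_eq1 pnatr_eq0 eqb1 eqb0 -orient //.
by split; apply: andb_idl; exact: simple_grid_complete.
Qed.

End MatrixOfSimpleGrid.

Lemma flow_grid_of_ASM_simple (R : realType) (n : nat) (A : 'M[R]_n) :
  is_ASM A -> simple_flow_grid (flow_grid_of A).
Proof.
move=> /ASM_height[h h_height ->]; rewrite flow_grid_of_asm //.
apply/simple_flow_gridP.
split=> [|b i j ib jb|i j i_n jn]; first exact: height_grid_complete.
  rewrite segment_height_grid // reversed_segment_height_grid //.
  by have := height_step h_height ib jb; lia.
rewrite !segment_height_grid //= ?addn0 ?addn1; try lia.
have := height_down h_height i_n jn; have := height_right h_height i_n jn.
have := height_down h_height i_n (ltnW jn).
have := height_right h_height (ltnW i_n) jn; lia.
Qed.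

Lemma simple_grid_height (R : realType) (n : nat) (G : grid n) :
  simple_flow_grid G -> exists2 h, height n 1 h & height_grid n 1 h = G.
Proof.
move=> simpleG; have [h h_height Gh] := ASM_height (grid_matrix_ASM R simpleG).
exists h => //.
by rewrite -(flow_grid_of_asm R h_height) -Gh flow_grid_of_grid_matrix.
Qed.

(** * Doubly directed regions *)

Section Cells.
Variable n : nat.
Implicit Types (S : {set cell n}) (c : cell n).
Local Notation segment := (segment n).

(* The position in the middle of the cell; these are the inner positions. *)
Definition at_pos c i j : bool := (c.1.+1 == i) && (c.2.+1 == j).

Definition at_cell (T : Type) (f : nat -> nat -> T) c : T := f c.1.+1 c.2.+1.

Definition indicator S i j : nat := \sum_(c in S) at_pos c i j.

Lemma inner_cell c : inner n c.1.+1 c.2.+1.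
Proof. by rewrite /inner; have := ltn_ord c.1; have := ltn_ord c.2; lia. Qed.

Lemma innerP i j : reflect (exists c, at_pos c i j) (inner n i j).
Proof.
apply: (iffP idP) => [/andP[i_in j_in]|[c /andP[/eqP <- /eqP <-]]];
  last exact: inner_cell.
have i_n : i.-1 < n.-1 by lia.
have jn : j.-1 < n.-1 by lia.
by exists (Ordinal i_n, Ordinal jn); rewrite /at_pos /= !prednK ?eqxx //; lia.
Qed.

Lemma at_pos_cell (T : Type) (f : nat -> nat -> T) c i j :
  at_pos c i j -> f i j = at_cell f c.
Proof. by case/andP => /eqP <- /eqP <-. Qed.

Lemma at_posE c c' : at_cell (at_pos c) c' = (c == c').
Proof.
by case: c c' => [i j] [i' j']; rewrite /at_cell /at_pos !eqSS xpair_eqE.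
Qed.

Lemma indicator_cell S c : at_cell (indicator S) c = (c \in S).
Proof.
have [cS|cS] := boolP (c \in S).
  rewrite /at_cell /indicator (bigD1 c) //= -/(at_cell _ _) at_posE eqxx.
  by rewrite big1 // => c' /andP[_ c'c];
    rewrite -/(at_cell _ _) at_posE (negbTE c'c).
rewrite /at_cell /indicator big1 // => c' c'S; rewrite -/(at_cell _ _) at_posE.
by case: eqVneq c'S => // ->; rewrite (negbTE cS).
Qed.

Lemma indicator_outer S i j : ~~ inner n i j -> indicator S i j = 0.
Proof.
move=> ij; rewrite /indicator big1 // => c _; apply/eqP; rewrite eqb0.
by apply: contraNN ij => cij; apply/innerP; exists c.
Qed.

Lemma indicator_le1 S i j : indicator S i j <= 1.
Proof.
have [/innerP[c /at_pos_cell->]|/indicator_outer->//] := boolP (inner n i j).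
by rewrite indicator_cell leq_b1.
Qed.

Lemma mem_sides c (b : bool) i j : i + b <= n -> j + ~~ b <= n ->
  (segment b i j \in sides c) = at_pos c i j || at_pos c (i + b) (j + ~~ b).
Proof.
case: c => k l; have kn := ltn_ord k; have ln := ltn_ord l.
by case: b; rewrite !inE !eq_edge /at_pos /= addn0 addn1 => ? ?;
  rewrite !eq_vtx; lia.
Qed.

Lemma sides_segment c s : s \in sides c ->
  exists (b : bool) i j, [/\ i + b <= n, j + ~~ b <= n & s = segment b i j].
Proof.
case: c => k l; have kn := ltn_ord k; have ln := ltn_ord l.
rewrite !inE /= => /orP[/orP[/orP[]|]|] /eqP ->.
- by exists true, k, l.+1; rewrite /segment /= addn0 addn1; split=> //; lia.
- by exists true, k.+1, l.+1; rewrite /segment /= addn0 addn1; split=> //; lia.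
- by exists false, k.+1, l; rewrite /segment /= addn0 addn1; split=> //; lia.
- by exists false, k.+1, l.+1; rewrite /segment /= addn0 addn1; split=> //; lia.
Qed.

Lemma side_count_segment S (b : bool) i j : i + b <= n -> j + ~~ b <= n ->
  side_count S (segment b i j) =
    indicator S i j + indicator S (i + b) (j + ~~ b).
Proof.
move=> ib jb; rewrite /side_count /indicator -big_split -sum1_card /=.
rewrite big_mkcond [RHS]big_mkcond; apply: eq_bigr => c _;
  rewrite finset.in_set.
have : ~~ (at_pos c i j && at_pos c (i + b) (j + ~~ b)).
  by rewrite /at_pos; case: b {ib jb}; rewrite addn0 addn1; lia.
rewrite mem_sides //; case: (c \in S) => //=.
by case: (at_pos _ _ _) (at_pos _ _ _) => [] [].
Qed.

Lemma side_count_gt0 S s : 0 < side_count S s ->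
  exists (b : bool) i j, [/\ i + b <= n, j + ~~ b <= n & s = segment b i j].
Proof. by move/card_gt0P => [c]; rewrite inE => /andP[_] /sides_segment. Qed.

End Cells.

Arguments at_pos {n} c (i j)%_N.
Arguments indicator {n} S (i j)%_N.

Section Regions.
Variables (R : realType) (n : nat) (G : grid n).
Implicit Types (S : {set cell n}) (c : cell n) (d : nat -> nat -> R).
Local Notation segment := (segment n).
Local Open Scope ring_scope.

Definition doubled (b : bool) i j : bool :=
  double_directed G (segment b i j).1 (segment b i j).2.

Lemma doubledE (b : bool) i j :
  doubled b i j = (segment b i j \in G) && (reversed (segment b i j) \in G).
Proof. by []. Qed.

Lemma regionP S : doubly_directed_region G S <->
  cell_connected S /\
  forall (b : bool) i j, (i + b <= n)%N -> (j + ~~ b <= n)%N ->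
    let sides := (indicator S i j + indicator S (i + b) (j + ~~ b))%N in
    (sides = 1%N -> doubled b i j) /\ (sides = 2 -> ~~ doubled b i j).
Proof.
split=> [/and3P[connS /forallP border /forallP interior]|[connS sidesS]].
  split=> // b i j ib jb /=; rewrite -side_count_segment //.
  by split=> /eqP; [exact: implyP (border _)|exact: implyP (interior _)].
have count_sides s : (0 < side_count S s)%N ->
    (side_count S s = 1%N -> double_directed G s.1 s.2) /\
    (side_count S s = 2 -> ~~ double_directed G s.1 s.2).
  by case/side_count_gt0 => b [i [j [ib jb ->]]]; rewrite side_count_segment //;
    exact: sidesS.
apply/and3P; split=> //; apply/forallP => s; apply/implyP => /eqP count_s.
  by have [|+ _] := count_sides s; [rewrite count_s|exact].
by have [|_] := count_sides s; [rewrite count_s|exact].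
Qed.

Lemma indicator_across S (b : bool) i j : doubly_directed_region G S ->
  (i + b <= n)%N -> (j + ~~ b <= n)%N -> ~~ doubled b i j ->
  indicator S (i + b) (j + ~~ b) = indicator S i j.
Proof.
move=> /regionP[_ sidesS] ib jb /negP undoubled.
have [border _] := sidesS b i j ib jb.
have := indicator_le1 S i j; have := indicator_le1 S (i + b)%N (j + ~~ b)%N.
move: (indicator S i j) (indicator S (i + b) (j + ~~ b)) border.
by move=> [|[]] [|[]] //= border _ _; case: undoubled; exact: border.
Qed.

(* Perturbations of corner sums along a face: constant across every segment
   whose orientation is the same at all vertices of the face *)
Record compatible d : Prop := Compatible {
  compat_outer : forall i j, ~~ inner n i j -> d i j = 0;
  compat_across : forall (b : bool) i j, (i + b <= n)%N -> (j + ~~ b <= n)%N ->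
    ~~ doubled b i j -> d (i + b)%N (j + ~~ b)%N = d i j }.

Lemma compat_lin (x y : R) d d' : compatible d -> compatible d' ->
  compatible (fun i j => x * d i j + y * d' i j).
Proof.
move=> dG dG'; split=> [i j ij|b i j ib jb undoubled].
  by rewrite (compat_outer dG) ?(compat_outer dG') // !mulr0 addr0.
by rewrite (compat_across dG) ?(compat_across dG').
Qed.

Lemma compat_indicator S : doubly_directed_region G S ->
  compatible (fun i j => (indicator S i j)%:R).
Proof.
move=> Sreg; split=> [i j /indicator_outer-> //|b i j ib jb undoubled].
by rewrite (indicator_across Sreg).
Qed.

Lemma at_indicator S c :
  at_cell (fun i j => (indicator S i j)%:R : R) c = (c \in S)%:R.
Proof. by rewrite -indicator_cell. Qed.

Lemma compat_height_diff (h h' : nat -> nat -> nat) :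
  height n 1 h -> height n 1 h' ->
  height_grid n 1 h \subset G -> height_grid n 1 h' \subset G ->
  compatible (fun i j => (h i j)%:R - (h' i j)%:R).
Proof.
move=> h_height h'_height /fintype.subsetP hG /fintype.subsetP hG'.
split=> [i j ij|b i j ib jb undoubled].
  by rewrite (height_outer h_height) ?(height_outer h'_height) // subrr.
have same_jump :
    (h (i + b) (j + ~~ b) + h' i j = h i j + h' (i + b) (j + ~~ b))%N.
  move: undoubled; rewrite doubledE.
  have := hG (segment b i j); have := hG (reversed (segment b i j)).
  have := hG' (segment b i j); have := hG' (reversed (segment b i j)).
  have := height_step h_height ib jb; have := height_step h'_height ib jb.
  rewrite !segment_height_grid // !reversed_segment_height_grid //=; lia.
by move/(congr1 (fun x => x%:R : R)): same_jump; rewrite !natrD; lra.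
Qed.

Definition cell_link : rel (cell n) := fun c c' =>
  [exists s : edge n, [&& s \in sides c, s \in sides c' &
                          ~~ double_directed G s.1 s.2]].

Definition component c : {set cell n} := [set c' | connect cell_link c c']%SET.

Lemma segment_link c c' (b : bool) i j :
  (i + b <= n)%N -> (j + ~~ b <= n)%N -> ~~ doubled b i j ->
  at_pos c i j || at_pos c (i + b) (j + ~~ b) ->
  at_pos c' i j || at_pos c' (i + b) (j + ~~ b) -> cell_link c c'.
Proof.
move=> ib jb undoubled cs cs'; apply/existsP; exists (segment b i j).
by rewrite !mem_sides // cs cs'.
Qed.

Lemma compat_link d c c' : compatible d -> cell_link c c' ->
  at_cell d c = at_cell d c'.
Proof.
move=> dG /existsP[s /and3P[sc + +]].
have [b [i [j [ib jb sE]]]] := sides_segment sc; move: sc; rewrite {s}sE.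
rewrite !mem_sides // => cs cs' /(compat_across dG ib jb) across.
by case/orP: cs => /at_pos_cell <-; case/orP: cs' => /at_pos_cell <-.
Qed.

Lemma compat_connect d c c' : compatible d -> connect cell_link c c' ->
  at_cell d c = at_cell d c'.
Proof.
move=> dG /connectP[p]; elim: p c => [c _ -> //|c1 p IHp c /=].
by move=> /andP[link_c path_p] last_p; rewrite (compat_link dG link_c) (IHp c1).
Qed.

Lemma mem_component c : c \in component c.
Proof. by rewrite inE. Qed.

Lemma component_closed c x y : x \in component c -> cell_link x y ->
  y \in component c.
Proof. by rewrite !inE => cx xy; apply: connect_trans cx (connect1 xy). Qed.

Lemma compat_component d c i j : compatible d ->
  indicator (component c) i j = 1%N -> d i j = at_cell d c.
Proof.
move=> dG; have [/innerP[x xij]|/indicator_outer-> //] := boolP (inner n i j).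
rewrite !(at_pos_cell _ xij) indicator_cell inE.
by case: (boolP (connect _ _ _)) => // /(compat_connect dG).
Qed.

Lemma component_connected c : cell_connected (component c).
Proof.
set S := component c.
have from_S x p : x \in S -> path cell_link x p ->
  connect (cell_adj S) x (last x p).
  elim: p x => [x _ _|y p IHp x xS /= /andP[xy path_p]]; first exact: connect0.
  have yS := component_closed xS xy; apply: connect_trans (IHp y yS path_p).
  apply: connect1; rewrite /cell_adj xS yS /=.
  case/existsP: xy => s /and3P[sx sy _].
  by apply/finset.set0Pn; exists s; rewrite inE sx.
have from_c x : x \in S -> connect (cell_adj S) c x.
  by rewrite inE => /connectP[p path_p ->];
    exact: from_S (mem_component c) path_p.
have symS : connect_sym (cell_adj S).
  by apply: sym_connect_sym => x y; rewrite /cell_adj andbCA finset.setIC.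
apply/andP; split; first by apply/finset.set0Pn; exists c; exact: mem_component.
apply/'forall_implyP => x xS; apply/'forall_implyP => y yS.
by apply: connect_trans (from_c y yS); rewrite symS from_c.
Qed.

Lemma region_adj_link S x y : doubly_directed_region G S -> cell_adj S x y ->
  connect cell_link x y.
Proof.
move=> /regionP[_ sidesS] /and3P[xS yS /finset.set0Pn[s]].
rewrite inE => /andP[sx sy].
have [->|xy] := eqVneq x y; first exact: connect0.
have [b [i [j [ib jb sE]]]] := sides_segment sx.
move: sx sy; rewrite {s}sE => sx sy.
apply/connect1/existsP; exists (segment b i j); rewrite sx sy /=.
have [_] := sidesS b i j ib jb; apply; rewrite -side_count_segment //.
apply/eqP; rewrite eqn_leq; apply/andP; split.
  by rewrite side_count_segment // (@leq_add _ _ 1 1) // indicator_le1.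
have <- : #|[set x; y]%SET| = 2 by rewrite cards2 xy.
apply/subset_leq_card/fintype.subsetP => z.
by rewrite in_set2 => /orP[] /eqP ->; rewrite finset.in_set ?xS ?yS.
Qed.

Lemma region_component S c : doubly_directed_region G S -> c \in S ->
  S = component c.
Proof.
move=> Sreg cS; have [/andP[_ /'forall_implyP connS] _] := (regionP S).1 Sreg.
apply/setP => x; rewrite inE.
apply/idP/idP => [xS|/(compat_connect (compat_indicator Sreg))].
  have /'forall_implyP/(_ x xS) := connS c cS.
  exact: (connect_sub (fun y z => region_adj_link Sreg)).
by rewrite !at_indicator cS => /eqP; rewrite eqr_nat; case: (x \in S).
Qed.

Lemma region_cell S : doubly_directed_region G S -> exists c, c \in S.
Proof. by case/regionP => /andP[/finset.set0Pn]. Qed.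

(* An undoubled segment on the border of a component separates it from the
   outside, where [d] vanishes. *)
Lemma compat_component_exit d c (b : bool) i j : compatible d ->
  (i + b <= n)%N -> (j + ~~ b <= n)%N -> ~~ doubled b i j ->
  indicator (component c) i j <> indicator (component c) (i + b) (j + ~~ b) ->
  at_cell d c = 0.
Proof.
move=> dG ib jb undoubled; have across := compat_across dG ib jb undoubled.
have link x y := segment_link (c := x) (c' := y) ib jb undoubled.
have exit k l k' l' : d k l = d k' l' ->
    (forall x y, at_pos x k l -> at_pos y k' l' -> cell_link x y) ->
    indicator (component c) k l = 1%N -> indicator (component c) k' l' = 0%N ->
    at_cell d c = 0.
  move=> dE links in1 out0; rewrite -(compat_component dG in1) dE.
  apply: (compat_outer dG); apply: contra_eqN out0 => /innerP[y ykl].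
  have /innerP[x xkl] : inner n k l.
    by apply: contra_eqT in1 => /indicator_outer->.
  rewrite (at_pos_cell _ ykl) indicator_cell eqb0 negbK.
  apply: component_closed (links x y xkl ykl).
  by move: in1; rewrite (at_pos_cell _ xkl) indicator_cell; case: (_ \in _).
have near_le1 := indicator_le1 (component c) i j.
have far_le1 := indicator_le1 (component c) (i + b)%N (j + ~~ b)%N => neq.
have [near_far|near_far] : indicator (component c) i j = 1%N /\
      indicator (component c) (i + b) (j + ~~ b) = 0%N \/
    indicator (component c) i j = 0%N /\
      indicator (component c) (i + b) (j + ~~ b) = 1%N by lia.
- case: near_far => near far.
  by apply: exit near far => [//|x y xs ys]; apply: link; rewrite ?xs ?ys ?orbT.
- case: near_far => near far.
  by apply: exit far near => [//|x y xs ys]; apply: link; rewrite ?xs ?ys ?orbT.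
Qed.

Hypothesis elemG : elementary_flow_grid G.

Lemma elementary_covered e : e \in G ->
  exists h, [/\ height n 1 h, height_grid n 1 h \subset G
               & e \in height_grid n 1 h].
Proof.
case: elemG => X simpleX GE; rewrite {1}GE => /finset.bigcupP[S SX eS].
have [h h_height hS] := simple_grid_height R (simpleX S SX).
exists h; rewrite hS; split=> //.
by rewrite GE; exact: finset.bigcup_sup.
Qed.

Lemma elementary_complete : G \subset complete_flow_grid n.
Proof.
apply/fintype.subsetP => e /elementary_covered[h [_ _]].
exact: fintype.subsetP (height_grid_complete _ _ _) e.
Qed.

Lemma doubled_separated (b : bool) i j : (i + b <= n)%N -> (j + ~~ b <= n)%N ->
  doubled b i j -> exists2 d, compatible d & d (i + b)%N (j + ~~ b)%N <> d i j.
Proof.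
move=> ib jb; rewrite doubledE => /andP[/elementary_covered hP].
move=> /elementary_covered[h' [h'_height hG' +]].
have [h [h_height hG +]] := hP.
rewrite segment_height_grid // reversed_segment_height_grid //.
move=> jump1 jump0; exists (fun i j => (h i j)%:R - (h' i j)%:R).
  exact: compat_height_diff.
have -> : h' (i + b)%N (j + ~~ b)%N = h' i j.
  by have := height_step h'_height ib jb; lia.
by move/eqP; rewrite (inj_eq (addIr _)) eqr_nat; lia.
Qed.

Lemma compat_no_region d c : compatible d ->
  ~~ doubly_directed_region G (component c) -> at_cell d c = 0.
Proof.
move=> dG; apply: contraNeq => dc0; apply/regionP.
split=> [|b i j ib jb /=]; first exact: component_connected.
have := indicator_le1 (component c) i j.
have := indicator_le1 (component c) (i + b)%N (j + ~~ b)%N => far1 near1.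
split=> sides.
  apply: contra_neqT dc0 => undoubled.
  by apply: compat_component_exit dG ib jb undoubled _; lia.
apply/negP => /(doubled_separated ib jb)[d' dG'].
by rewrite !(compat_component (c := c) dG') //; lia.
Qed.

Definition value_on d S : R :=
  if [pick c in S] is Some c then at_cell d c else 0.

Lemma value_onE d S c : compatible d -> doubly_directed_region G S -> c \in S ->
  value_on d S = at_cell d c.
Proof.
move=> dG Sreg cS; rewrite /value_on; case: pickP => [c' c'S|/(_ c)];
  last by rewrite cS.
by apply: compat_connect dG _; move: cS;
  rewrite (region_component Sreg c'S) inE.
Qed.

Lemma compat_decomp d i j : compatible d ->
  d i j =
  \sum_(S | doubly_directed_region G S) value_on d S * (indicator S i j)%:R.
Proof.
move=> dG; have [/innerP[c cij]|out] := boolP (inner n i j); last first.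
  by rewrite big1 ?(compat_outer dG) // => S _;
    rewrite indicator_outer // mulr0.
rewrite (at_pos_cell _ cij).
under eq_bigr do rewrite (at_pos_cell _ cij) indicator_cell.
have off_c S : doubly_directed_region G S -> S != component c ->
    value_on d S * (c \in S)%:R = 0.
  move=> Sreg; have [/(region_component Sreg)->|_ _] := boolP (c \in S).
    by rewrite eqxx.
  by rewrite mulr0.
have [creg|creg] := boolP (doubly_directed_region G (component c)); last first.
  rewrite (compat_no_region dG creg) big1 // => S Sreg; apply: off_c => //.
  by apply: contraNneq creg => <-.
rewrite (bigD1 (component c)) //= mem_component mulr1.
rewrite (value_onE dG creg (mem_component c)).
by rewrite big1 ?addr0 // => S /andP[]; exact: off_c.
Qed.

End Regions.

Lemma height_add_region n N H (S : {set cell n}) : height n N H ->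
  doubly_directed_region (height_grid n N H) S ->
  height n N (fun i j => H i j + indicator S i j) /\
  height_grid n N (fun i j => H i j + indicator S i j)
    \subset height_grid n N H.
Proof.
move=> H_height Sreg.
have step (b : bool) i j : i + b <= n -> j + ~~ b <= n ->
    indicator S (i + b) (j + ~~ b) = indicator S i j \/
    H i j < H (i + b) (j + ~~ b) < H i j + N.
  move=> ib jb; have [|undoubled] := boolP (doubled (height_grid n N H) b i j).
    rewrite doubledE segment_height_grid // reversed_segment_height_grid //.
    by right.
  by left; exact: indicator_across undoubled.
have HS_height : height n N (fun i j => H i j + indicator S i j).
  split=> [i j ij|b i j ib jb].
    by rewrite (height_outer H_height ij) indicator_outer ?addn0.
  have := indicator_le1 S i j; have := indicator_le1 S (i + b) (j + ~~ b).
  by have := height_step H_height ib jb; case: (step b i j ib jb); lia.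
split=> //.
apply: sub_grid_segments (height_grid_complete _ _ _) _ => b i j ib jb.
rewrite !segment_height_grid // !reversed_segment_height_grid //.
have := indicator_le1 S i j; have := indicator_le1 S (i + b) (j + ~~ b).
by case: (step b i j ib jb); split; lia.
Qed.

(** * Circulations and cycles *)

Section Circulations.
Variables (R : realDomainType) (T : finType).
Local Open Scope ring_scope.

Record circulation (e : rel T) (f : T -> T -> R) : Prop := Circulation {
  circ_anti : forall v w, f v w = - f w v;
  circ_conserved : forall v, \sum_w f v w = 0;
  circ_support : forall v w, f v w != 0 -> e v w }.

Lemma positive_cycle_size (f : T -> T -> R) c : (forall v w, f v w = - f w v) ->
  c != [::] -> cycle (fun v w => 0 < f v w) c -> (2 < size c)%N.
Proof.
move=> fN; case: c => [|v [|w []]] //= _.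
  by rewrite andbT => fv; have := fN v v; lra.
by rewrite andbT => /andP[fvw fwv]; have := fN v w; lra.
Qed.

(* Whatever enters a vertex leaves it, so the positive edges can be followed
   until they close up. *)
Lemma circulation_cycle e f v0 w0 : circulation e f -> f v0 w0 != 0 ->
  exists c, (2 < size c)%N /\ ucycle (fun v w => 0 < f v w) c.
Proof.
move=> [fN f_conserved _] fv0.
pose live v := [exists w, 0 < f v w].
pose succ v := odflt v [pick w | 0 < f v w].
have live_succ v : live v -> 0 < f v (succ v).
  by rewrite /succ => /existsP[w fw]; case: pickP => //= /(_ w); rewrite fw.
have succ_live v : live v -> live (succ v).
  move=> /live_succ fv; apply: contraT.
  rewrite /live negb_exists => /forallP nw.
  have : \sum_w f (succ v) w < 0.
    rewrite (bigD1 v) //= -[ltRHS]addr0 ltr_leD //.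
      by rewrite fN oppr_lt0.
    by apply: sumr_le0 => w _; rewrite leNgt nw.
  by rewrite f_conserved ltxx.
have [x live_x] : exists x, live x.
  case: (ltgtP (f v0 w0) 0) fv0 => // fv _.
    by exists w0; apply/existsP; exists v0; rewrite fN oppr_gt0.
  by exists v0; apply/existsP; exists w0.
have [k fcycle_c] := orbit_eventually_cycle succ x.
set c := orbit _ _ in fcycle_c; exists c.
have live_c : all live c.
  apply/allP => v; rewrite /c -fconnect_orbit => /iter_findex <-.
  by rewrite -iterD; elim: (_ + _)%N => //= m; exact: succ_live.
have pos_c : cycle (fun v w => 0 < f v w) c.
  by apply: sub_in_cycle live_c fcycle_c => v w /live_succ + _ /= /eqP <-.
split; last by rewrite /ucycle pos_c orbit_uniq.
apply: positive_cycle_size pos_c => //.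
by rewrite -size_eq0 size_orbit -lt0n fingraph.order_gt0.
Qed.

End Circulations.

Section CycleFlow.
Variables (R : realDomainType) (T : finType) (e : rel T) (c : seq T).
Hypothesis (e_sym : symmetric e).
Hypotheses (c_size : (2 < size c)%N) (c_cycle : ucycle e c).
Local Open Scope ring_scope.

Definition cycle_flow v w : R :=
  ((v \in c) && (w == next c v))%:R - ((w \in c) && (v == next c w))%:R.

Lemma next_next_neq v : v \in c -> next c (next c v) != v.
Proof.
case/andP: c_cycle => _ c_uniq /rot_to[k s c_rot].
rewrite -!(next_rot k c_uniq); move: c_size c_uniq.
rewrite -(size_rot k) -(rot_uniq k) c_rot.
case: s {c_rot} => [|a [|b s]] //= _ /andP[].
rewrite !inE !negb_or => /and3P[va vb _] _.
by rewrite !eqxx [a == v]eq_sym (negbTE va) eq_sym.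
Qed.

Lemma cycle_flow_neq0 v w : (cycle_flow v w != 0) =
  (v \in c) && (w == next c v) || (w \in c) && (v == next c w).
Proof.
rewrite /cycle_flow; have [/andP[vc /eqP ->]|_] := boolP ((v \in c) && _).
  by rewrite [v == _]eq_sym (negbTE (next_next_neq vc)) andbF subr0 oner_eq0.
by case: (_ && _); rewrite ?subrr ?eqxx // sub0r oppr_eq0 oner_eq0.
Qed.

Lemma cycle_flow_conserved v : \sum_w cycle_flow v w = 0.
Proof.
case/andP: c_cycle => _ c_uniq; rewrite sumrB.
have [vc|vc] := boolP (v \in c); last first.
  rewrite !big1 ?subrr // => w _; have [wc|//] := boolP (w \in c).
  by have [vw|//] := eqVneq v (next c w); rewrite vw mem_next wc in vc.
rewrite (bigD1 (next c v)) //= eqxx big1 => [|w /negbTE-> //].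
rewrite (bigD1 (prev c v)) //= mem_prev vc next_prev // eqxx.
rewrite big1 ?addr0 ?subrr // => w wv; have [wc /=|//] := boolP (w \in c).
by have [vw|//] := eqVneq v (next c w); case/eqP: wv; rewrite vw prev_next.
Qed.

Lemma circulation_cycle_flow : circulation e cycle_flow.
Proof.
split=> [v w||v w]; [by rewrite opprB|exact: cycle_flow_conserved|].
case/andP: c_cycle => cyc _; rewrite cycle_flow_neq0.
by case/orP => /andP[? /eqP->]; last rewrite e_sym; exact: next_cycle cyc _.
Qed.

End CycleFlow.

Section Flows.
Variables (R : realType) (n : nat).
Implicit Types (d : nat -> nat -> R) (v w : vertex n).
Local Notation vtx := (vtx n).
Local Open Scope ring_scope.

(* The circulation whose value on a directed edge is the jump of [d] from the
   position on its left to the one on its right *)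
Definition edge_jump d v w : R :=
  ((rightward (v, w))%:R - (downward (v, w))%:R) *
  (d v.1 v.2 - d w.1.-1 w.2.-1).

Definition flow d v w : R := edge_jump d v w - edge_jump d w v.

Lemma flowN d v w : flow d v w = - flow d w v.
Proof. by rewrite opprB. Qed.

Lemma flow_lin x y d d' v w :
  flow (fun i j => x * d i j + y * d' i j) v w =
    x * flow d v w + y * flow d' v w.
Proof. rewrite /flow /edge_jump; ring. Qed.

Lemma flow_right d i j : (i < n)%N -> (j <= n)%N ->
  flow d (vtx i.+1 j) (vtx i.+1 j.+1) = d i.+1 j - d i j.
Proof.
move=> i_n jn; rewrite /flow /edge_jump !direction_vtx ?eqxx ?eqn_succ; try lia.
by rewrite /= !inordK; try lia; rewrite /=; ring.
Qed.

Lemma flow_down d i j : (i <= n)%N -> (j < n)%N ->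
  flow d (vtx i j.+1) (vtx i.+1 j.+1) = d i j - d i j.+1.
Proof.
move=> i_n jn; rewrite /flow /edge_jump !direction_vtx ?eqxx ?eqn_succ; try lia.
by rewrite /= !inordK; try lia; rewrite /=; ring.
Qed.

Lemma sum_neighbours (g : vertex n -> R) i j : (i < n)%N -> (j < n)%N ->
  (forall w, (vtx i.+1 j.+1, w) \notin complete_flow_grid n -> g w = 0) ->
  \sum_w g w =
    g (vtx i.+1 j.+2) + g (vtx i.+1 j) + g (vtx i.+2 j.+1) + g (vtx i j.+1).
Proof.
move=> i_n jn g0.
pose s := [:: vtx i.+1 j.+2; vtx i.+1 j; vtx i.+2 j.+1; vtx i j.+1].
have s_uniq : uniq s by rewrite /= !inE !eq_vtx; lia.
rewrite (bigID (mem s)) /= [X in _ + X]big1 ?addr0.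
  by rewrite -(big_uniq _ s_uniq) /= !big_cons big_nil addr0 !addrA.
move=> w ws; apply: g0; apply: contraNN ws; rewrite -(vtx_val w).
have := ltn_ord w.1; have := ltn_ord w.2.
move: (nat_of_ord w.1) (nat_of_ord w.2) => k l ln kn.
rewrite !inE /= /horizontal /vertical !direction_vtx; try lia.
rewrite !eq_vtx; lia.
Qed.

Lemma flow_eq0 d : (forall i j, ~~ inner n i j -> d i j = 0) ->
  (forall v w, flow d v w = 0) -> forall i j, d i j = 0.
Proof.
move=> d0 f0 i j; have [|/d0 //] := boolP (inner n i j).
move=> /andP[/andP[_ i_n] /andP[_ jn]].
elim: i i_n => [|i IHi] i_n; first by rewrite d0.
have := f0 (vtx i.+1 j) (vtx i.+1 j.+1).
by rewrite flow_right ?(ltnW jn) 1?ltnW // IHi ?subr0 // ltnW.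
Qed.

Lemma edge_jump_segment d v w : (forall i j, ~~ inner n i j -> d i j = 0) ->
  edge_jump d v w != 0 -> exists (b : bool) i j,
  [/\ (i + b <= n)%N, (j + ~~ b <= n)%N, (v, w) = segment n b i j
    & d (i + b)%N (j + ~~ b)%N != d i j].
Proof.
move=> d0; rewrite -(vtx_val v) -(vtx_val w).
have := ltn_ord v.1; have := ltn_ord v.2.
have := ltn_ord w.1; have := ltn_ord w.2.
move: (nat_of_ord v.1) (nat_of_ord v.2) (nat_of_ord w.1) (nat_of_ord w.2).
move=> i j k l ln kn jn i_n; rewrite /edge_jump !direction_vtx // /= !inordK //.
rewrite mulf_eq0 negb_or !subr_eq0 => /andP[forward jump_neq0].
have : inner n i j || inner n k.-1 l.-1.
  by apply: contraNT jump_neq0; rewrite negb_or => /andP[/d0-> /d0->].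
rewrite /inner => is_inner.
have [/andP[/eqP ? /eqP ?]|not_right] := boolP ((k == i) && (l == j.+1)); subst.
  case: i {kn} i_n {forward} jump_neq0 is_inner; first by lia.
  move=> i i_n jump_neq0 is_inner.
  by exists true, i, j; rewrite /segment addn0 addn1; split=> //; lia.
have /andP[/eqP ? /eqP ?] : (l == j) && (k == i.+1).
  by move: forward; rewrite (negbTE not_right); case: (_ && _); rewrite ?eqxx.
subst; case: j {ln not_right forward} jn jump_neq0 is_inner; first by lia.
move=> j jn jump_neq0 is_inner.
by exists false, i, j; rewrite /segment addn0 addn1; split=> //; lia.
Qed.

End Flows.

Section CompatibleCirculations.
Variables (R : realType) (n : nat) (G : grid n).
Hypothesis elemG : elementary_flow_grid G.
Implicit Types (d : nat -> nat -> R) (v w : vertex n).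
Local Notation vtx := (vtx n).
Local Open Scope ring_scope.

Lemma double_directedC : symmetric (double_directed G).
Proof. by move=> v w; rewrite /double_directed andbC. Qed.

Lemma double_directed_complete v w : double_directed G v w ->
  (v, w) \in complete_flow_grid n.
Proof. by case/andP => /(fintype.subsetP (elementary_complete R elemG)). Qed.

Lemma double_directed_internal v w : double_directed G v w -> internal v.
Proof. by move/double_directed_complete; rewrite inE => /andP[]. Qed.

Lemma circulation_flow d : compatible G d ->
  circulation (double_directed G) (flow d).
Proof.
move=> dG; have d0 := compat_outer dG.
have jump_dd v w : edge_jump d v w != 0 -> double_directed G v w.
  move/(edge_jump_segment d0) => [b [i [j [ib jb [-> ->]]]]].
  by apply: contraNT => /(compat_across dG ib jb) ->.
have flow_dd v w : flow d v w != 0 -> double_directed G v w.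
  apply: contraNT => not_dd; rewrite subr_eq0; apply/eqP.
  transitivity (0 : R); last apply/esym; apply/eqP; apply: contraNT not_dd.
    exact: jump_dd.
  by rewrite double_directedC; exact: jump_dd.
split=> // [|v]; first exact: flowN.
have [/internal_vtxP[i [j [i_n jn ->]]]|out] := boolP (internal v); last first.
  rewrite big1 // => w _; apply/eqP; apply: contraNT out.
  by move=> /flow_dd/double_directed_internal.
rewrite (sum_neighbours i_n jn) => [|w out]; last first.
  by apply/eqP; apply: contraNT out => /flow_dd/double_directed_complete.
rewrite [flow d _ (vtx _ j)]flowN [flow d _ (vtx i _)]flowN.
rewrite !flow_right ?flow_down; try lia.
ring.
Qed.

Section Potential.
Variable f : vertex n -> vertex n -> R.
Hypothesis f_circ : circulation (double_directed G) f.

Definition potential i j : R := \sum_(k < i) f (vtx k.+1 j) (vtx k.+1 j.+1).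

Lemma circ_boundary v w : ~~ (internal v && internal w) -> f v w = 0.
Proof.
move=> out; apply/eqP; apply: contraNT out => /(circ_support f_circ) dd.
rewrite (double_directed_internal dd) /=.
by apply: (@double_directed_internal _ v); rewrite double_directedC.
Qed.

Lemma potential_right i j :
  potential i.+1 j - potential i j = f (vtx i.+1 j) (vtx i.+1 j.+1).
Proof. by rewrite /potential big_ord_recr /= addrAC subrr add0r. Qed.

Lemma potential_first j : potential 0 j = 0.
Proof. exact: big_ord0. Qed.

Lemma potential_down i j : (i <= n)%N -> (j < n)%N ->
  potential i j - potential i j.+1 = f (vtx i j.+1) (vtx i.+1 j.+1).
Proof.
elim: i => [|i IHi] i_n jn.
  by rewrite !potential_first subrr circ_boundary // internal_vtx.
have := circ_conserved f_circ (vtx i.+1 j.+1).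
rewrite (sum_neighbours i_n jn) => [|w out].
  rewrite (circ_anti f_circ _ (vtx i.+1 j)) (circ_anti f_circ _ (vtx i j.+1)).
  have := potential_right i j; have := potential_right i j.+1.
  have := IHi (ltnW i_n) jn; lra.
apply/eqP; apply: contraNT out.
by move=> /(circ_support f_circ)/double_directed_complete.
Qed.

Lemma potential_outer i j : ~~ inner n i j -> potential i j = 0.
Proof.
have col_out k l : ~~ (0 < l < n)%N -> potential k l = 0.
  by move=> out; apply: big1 => m _; apply: circ_boundary;
    rewrite !internal_vtx; lia.
have last_row l : potential n l = 0.
  elim: l => [|l IHl]; first exact: col_out.
  have [ln|nl] := ltnP l n; last by apply: col_out; lia.
  have := potential_down (leqnn n) ln; rewrite IHl circ_boundary; first by lra.
  by rewrite !internal_vtx; lia.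
rewrite negb_and => /orP[row_out|/col_out//].
have [->|i_gt0] := posnP i; first exact: potential_first.
have ni : (n <= i)%N by lia.
rewrite -(subnKC ni); elim: (i - n)%N => [|m IHm]; first by rewrite addn0.
have := potential_right (n + m) j; rewrite IHm subr0 addnS => ->.
by apply: circ_boundary; rewrite !internal_vtx; lia.
Qed.

Lemma potential_compat : compatible G potential.
Proof.
split=> [i j|b i j ib jb]; first exact: potential_outer.
move=> undoubled; have f0 : f (segment n b i j).1 (segment n b i j).2 = 0.
  by apply/eqP; apply: contraNT undoubled; exact: circ_support.
case: b ib jb {undoubled} f0; rewrite /= ?addn0 ?addn1 => ib jb.
  by rewrite -potential_right => /eqP; rewrite subr_eq0 => /eqP.
by rewrite -potential_down // => /eqP; rewrite subr_eq0 => /eqP.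
Qed.

Lemma flow_potential v w : flow potential v w = f v w.
Proof.
have flow_circ := circulation_flow potential_compat.
have [vwC|out] := boolP ((v, w) \in complete_flow_grid n); last first.
  have circ0 g : circulation (double_directed G) g -> g v w = 0.
    move=> g_circ; apply/eqP; apply: contraNT out.
    by move/(circ_support g_circ)/double_directed_complete.
  by rewrite !circ0.
have on_segment (b : bool) i j : (i + b <= n)%N -> (j + ~~ b <= n)%N ->
    flow potential (segment n b i j).1 (segment n b i j).2 =
    f (segment n b i j).1 (segment n b i j).2.
  case: b => /= ib jb; rewrite ?addn0 ?addn1 in ib jb *.
    by rewrite flow_right // potential_right.
  by rewrite flow_down // potential_down.
rewrite -[v]/(v, w).1 -[w in flow _ _ w]/(v, w).2 -[w in f _ w]/(v, w).2.
case/complete_edgeP: vwC => b i j ib jb; first exact: on_segment.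
by rewrite /= flowN (circ_anti f_circ) on_segment.
Qed.

End Potential.

End CompatibleCirculations.

Lemma double_directed_cycle_neq0 n (G : grid n) E :
  double_directed_cycle G E -> G != finset.set0.
Proof.
move=> [c [c_size /andP[cyc _] _]]; case: c c_size cyc => // v c _ cyc.
apply/finset.set0Pn; exists (v, next (v :: c) v).
by have /andP[] := next_cycle cyc (mem_head v c).
Qed.

Section RegionsAndCycles.
Variables (R : realType) (n : nat) (G : grid n).
Hypothesis elemG : elementary_flow_grid G.
Implicit Types (S : {set cell n}) (d : nat -> nat -> R) (c : seq (vertex n)).
Local Open Scope ring_scope.

Lemma compat_cycle d i j : compatible G d -> d i j != 0 ->
  exists c, [/\ (2 < size c)%N, ucycle (double_directed G) c
    & forall v w, (v, w) \in cycle_edges c -> flow d v w != 0].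
Proof.
move=> dG dij; have flow_circ := circulation_flow elemG dG.
have [v [w fvw]] : exists v w : vertex n, flow d v w != 0.
  have [//|no_flow] := pselect (exists v w : vertex n, flow d v w != 0).
  case/eqP: dij; apply: (flow_eq0 (compat_outer dG)) => v w.
  by apply/eqP/negPn/negP => fvw; apply: no_flow; exists v, w.
have [c [c_size /andP[pos_c c_uniq]]] := circulation_cycle flow_circ fvw.
exists c; split=> // [|x y].
  apply/andP; split=> //; apply: sub_cycle pos_c => x y fxy.
  by apply: (circ_support flow_circ); rewrite gt_eqF.
rewrite inE /= => /orP[/andP[xc /eqP->]|/andP[yc /eqP->]].
  by rewrite gt_eqF // (next_cycle pos_c xc).
by rewrite flowN oppr_eq0 gt_eqF // (next_cycle pos_c yc).
Qed.

Lemma cycle_edges_flow c : (2 < size c)%N -> ucycle (double_directed G) c ->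
  exists2 d : nat -> nat -> R, compatible G d
    & forall v w, ((v, w) \in cycle_edges c) = (flow d v w != 0).
Proof.
move=> c_size c_cycle.
have circ := circulation_cycle_flow R (double_directedC G) c_size c_cycle.
exists (potential (cycle_flow R c)); first exact: (potential_compat elemG circ).
move=> v w; rewrite (flow_potential elemG circ).
by rewrite (cycle_flow_neq0 R c_size c_cycle) inE.
Qed.

Lemma cycle_edges_next c : (2 < size c)%N ->
  exists v w, (v, w) \in cycle_edges c.
Proof.
by case: c => // v c _; exists v, (next (v :: c) v); rewrite inE /= inE !eqxx.
Qed.

Lemma one_region_one_cycle : num_regions G = 1%N ->
  exists! E : {set edge n}, double_directed_cycle G E.
Proof.
move=> /eqP/cards1P[S regS].
have only_S S' : doubly_directed_region G S' = (S' == S).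
  by have /setP/(_ S') := regS; rewrite !inE.
have Sreg : doubly_directed_region G S by rewrite only_S.
pose dS i j : R := (indicator S i j)%:R.
have flow_S d (v w : vertex n) : compatible G d ->
    flow d v w = value_on d S * flow dS v w.
  move=> dG; rewrite -[RHS]addr0 -[X in _ + X](mul0r (flow dS v w)) -flow_lin.
  congr (flow _ v w); apply/funext => i; apply/funext => j.
  rewrite mul0r addr0 (compat_decomp elemG i j dG).
  by rewrite (eq_bigl _ _ only_S) big_pred1_eq.
have edges_S c : (2 < size c)%N -> ucycle (double_directed G) c ->
    forall v w, ((v, w) \in cycle_edges c) = (flow dS v w != 0).
  move=> c_size c_cycle v w.
  have [d dG d_edges] := cycle_edges_flow c_size c_cycle.
  have [x [y]] := cycle_edges_next c_size.
  by rewrite !d_edges !(flow_S d) // !mulf_eq0 !negb_or => /andP[-> _].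
have [x xS] := region_cell Sreg.
have [|c [c_size c_cycle _]] :=
    compat_cycle (i := x.1.+1) (j := x.2.+1) (compat_indicator R Sreg).
  by rewrite -[indicator _ _ _]/(at_cell _ x) indicator_cell xS oner_eq0.
exists (cycle_edges c); split; first by exists c.
move=> _ [c' [c'_size c'_cycle ->]]; apply/setP => -[v w].
by rewrite !edges_S.
Qed.

Lemma regions_avoid_edge S S' (v w : vertex n) :
  doubly_directed_region G S -> doubly_directed_region G S' -> S != S' ->
  exists2 d : nat -> nat -> R, compatible G d
    & flow d v w = 0 /\ exists i j, d i j != 0.
Proof.
move=> Sreg S'reg SS'.
pose dS i j : R := (indicator S i j)%:R.
pose dS' i j : R := (indicator S' i j)%:R.
have [flow0|flow_neq0] := eqVneq (flow dS v w) 0.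
  have [x xS] := region_cell Sreg; exists dS; first exact: compat_indicator.
  split=> //; exists x.1.+1, x.2.+1.
  by rewrite -[dS _ _]/(at_cell dS x) at_indicator xS oner_eq0.
exists (fun i j => flow dS' v w * dS i j + - flow dS v w * dS' i j).
  exact: compat_lin (compat_indicator _ Sreg) (compat_indicator _ S'reg).
rewrite flow_lin mulrC mulNr subrr; split=> //.
have [x xS'] := region_cell S'reg; exists x.1.+1, x.2.+1.
have xS : x \notin S.
  apply: contra SS' => xS; rewrite (region_component R Sreg xS).
  by rewrite -(region_component R S'reg xS').
rewrite -[dS _ _]/(at_cell dS x) -[dS' _ _]/(at_cell dS' x) !at_indicator.
by rewrite xS' (negbTE xS) mulr0 add0r mulr1 oppr_eq0.
Qed.

Lemma one_cycle_one_region :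
  (exists! E : {set edge n}, double_directed_cycle G E) -> num_regions G = 1%N.
Proof.
move=> [E [[c [c_size c_cycle E_c]] E_uniq]].
have [v [w vw]] := cycle_edges_next c_size.
have [d dG d_edges] := cycle_edges_flow c_size c_cycle.
have flow_vw : flow d v w != 0 by rewrite -d_edges.
have [S Sreg] : exists S, doubly_directed_region G S.
  have [S Sreg|no_region] := pickP (doubly_directed_region G);
    first by exists S.
  case/eqP: flow_vw; suff -> : d = fun _ _ => 0.
    by rewrite /flow /edge_jump; ring.
  apply/funext => i; apply/funext => j.
  by rewrite (compat_decomp elemG i j dG) big_pred0.
apply/eqP/cards1P; exists S; apply/setP => S'; rewrite !inE.
apply/idP/eqP => [S'reg|-> //]; apply/eqP; rewrite eq_sym; apply/negPn/negP.
move=> /(regions_avoid_edge v w Sreg S'reg)[d' d'G [flow0 [i [j dij]]]].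
have [c' [c'_size c'_cycle flow_c']] := compat_cycle d'G dij.
suff /flow_c' : (v, w) \in cycle_edges c' by rewrite flow0 eqxx.
by rewrite -(E_uniq (cycle_edges c')) ?E_c //; exists c'.
Qed.

End RegionsAndCycles.

(** * Convex hulls and their faces *)

Local Notation dotmx := Defs.dotmx.

Section ConvexHulls.
Variables (R : realType) (n : nat).
Implicit Types (C A X Y : 'M[R]_n) (S F : set 'M[R]_n).
Local Open Scope ring_scope.
Local Open Scope classical_set_scope.

Lemma dotmx_sum C (I : Type) (r : seq I) (P : pred I) (p : I -> 'M[R]_n) :
  dotmx C (\sum_(i <- r | P i) p i) = \sum_(i <- r | P i) dotmx C (p i).
Proof.
rewrite /dotmx [RHS]exchange_big; apply: eq_bigr => i _ /=.
rewrite [RHS]exchange_big; apply: eq_bigr => j _ /=.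
by rewrite summxE mulr_sumr.
Qed.

Lemma dotmxZ C a X : dotmx C (a *: X) = a * dotmx C X.
Proof.
rewrite /dotmx mulr_sumr; apply: eq_bigr => i _.
by rewrite mulr_sumr; apply: eq_bigr => j _; rewrite mxE mulrCA.
Qed.

Lemma dotmxD C X Y : dotmx C (X + Y) = dotmx C X + dotmx C Y.
Proof.
rewrite /dotmx -big_split; apply: eq_bigr => i _ /=.
by rewrite -big_split; apply: eq_bigr => j _ /=; rewrite mxE mulrDr.
Qed.

Lemma dotmx_comb C k (p : 'I_k -> 'M[R]_n) (a : 'I_k -> R) :
  dotmx C (\sum_i a i *: p i) = \sum_i a i * dotmx C (p i).
Proof. by rewrite dotmx_sum; under eq_bigr do rewrite dotmxZ. Qed.

Lemma scalar_dotmx (phi : 'M[R]_n -> R) : scalar phi ->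
  exists C, forall X, dotmx C X = phi X.
Proof.
move=> phi_lin; exists (\matrix_(i, j) phi (delta_mx i j)) => X.
pose phi_isLinear := GRing.isLinear.Build _ _ _ _ phi phi_lin.
pose psi : {scalar 'M[R]_n} := HB.pack phi phi_isLinear.
rewrite -[phi X]/(psi X) [in RHS](matrix_sum_delta X) linear_sum /dotmx.
apply: eq_bigr => i _; rewrite linear_sum; apply: eq_bigr => j _.
by rewrite linearZ mxE mulrC.
Qed.

Lemma sum1_neq0 k (a : 'I_k -> R) : \sum_i a i = 1 -> exists i, a i != 0.
Proof.
move=> a1; have [i ai|a0] := pickP (fun i => a i != 0); first by exists i.
move: a1; rewrite big1 => [/esym/eqP|i _]; first by rewrite oner_eq0.
by apply/eqP/negbFE/a0.
Qed.

Lemma convex_comb_max k (a f : 'I_k -> R) b : (forall i, 0 <= a i) ->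
  \sum_i a i = 1 -> (forall i, f i <= b) -> \sum_i a i * f i = b ->
  forall i, a i != 0 -> f i = b.
Proof.
move=> a_ge0 a1 fb af i ai.
have /psumr_eq0P slack0 : \sum_i a i * (b - f i) = 0.
  under eq_bigr do rewrite mulrBr.
  by rewrite sumrB -mulr_suml a1 mul1r af subrr.
have slack_ge0 l : 0 <= a l * (b - f l) by rewrite mulr_ge0 ?subr_ge0.
have /eqP := slack0 (fun l _ => slack_ge0 l) i isT.
by rewrite mulf_eq0 (negbTE ai) subr_eq0 => /eqP.
Qed.

Lemma sub_conv_hull S : S `<=` conv_hull S.
Proof.
by move=> A SA; exists 1%N, (fun=> A), (fun=> 1); split=> //;
  rewrite big_ord1 ?scale1r.
Qed.

Lemma conv_hull_nonempty S : conv_hull S !=set0 -> S !=set0.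
Proof. by move=> [X [k [p [a [Sp _ /sum1_neq0[i _] _]]]]]; exists (p i). Qed.

Lemma conv_hull1 A : conv_hull [set A] = [set A].
Proof.
apply/seteqP; split; last exact: sub_conv_hull.
move=> _ [k [p [a [pA _ a1 ->]]]] /=.
by under eq_bigr do rewrite pA; rewrite -scaler_suml a1 scale1r.
Qed.

Lemma conv_hull_dotmx_le S C b X :
  S `<=` [set A | dotmx C A <= b] -> conv_hull S X -> dotmx C X <= b.
Proof.
move=> Cb [k [p [a [Sp a_ge0 a1 ->]]]]; rewrite dotmx_comb.
rewrite -[leRHS]mul1r -a1 mulr_suml; apply: ler_sum => i _.
by rewrite ler_wpM2l //; exact: Cb.
Qed.

Lemma conv_hull_max S C b : S `<=` [set A | dotmx C A <= b] ->
  [set X | conv_hull S X /\ dotmx C X = b] =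
  conv_hull [set A | S A /\ dotmx C A = b].
Proof.
move=> Cb; apply/seteqP; split=> X /=; last first.
  move=> [k [p [a [Sp a_ge0 a1 ->]]]]; split.
    by exists k, p, a; split=> // i; case: (Sp i).
  rewrite dotmx_comb (eq_bigr (fun i => a i * b)) => [|i _];
    last by case: (Sp i) => _ ->.
  by rewrite -mulr_suml a1 mul1r.
move=> [[k [p [a [Sp a_ge0 a1 XE]]]] CX]; have [i0 ai0] := sum1_neq0 a1.
have p_max i : a i != 0 -> dotmx C (p i) = b.
  apply: (@convex_comb_max k a (fun i => dotmx C (p i))) => // [l|];
    first exact: Cb.
  by rewrite -dotmx_comb -XE.
exists k, (fun i => if a i == 0 then p i0 else p i), a; split=> // [i|].
  by case: ifPn => [_|/p_max]; split=> //; exact: p_max.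
by rewrite XE; apply: eq_bigr => i _; case: eqP => // ->; rewrite !scale0r.
Qed.

Lemma is_face_conv_hull S C b : S `<=` [set A | dotmx C A <= b] ->
  is_face (conv_hull S) (conv_hull [set A | S A /\ dotmx C A = b]).
Proof.
move=> Cb; exists C, b; split=> [X|]; first exact: conv_hull_dotmx_le.
by rewrite conv_hull_max.
Qed.

Lemma face_conv_hull S F : is_face (conv_hull S) F -> F = conv_hull (S `&` F).
Proof.
move=> [C [b [Cb FE]]]; have SCb : S `<=` [set A | dotmx C A <= b].
  by move=> A /sub_conv_hull/Cb.
rewrite {1}FE conv_hull_max //; congr conv_hull; rewrite FE.
apply/seteqP; split=> A [SA] /=; last by case.
by move=> CA; split=> //; split=> //; exact: sub_conv_hull.
Qed.

End ConvexHulls.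

Section AffineHulls.
Variables (R : realType) (n : nat).
Implicit Types (A B X Y : 'M[R]_n) (S F : set 'M[R]_n).
Local Open Scope ring_scope.
Local Open Scope classical_set_scope.

Lemma aff_hull_comb F (I : finType) (p : I -> 'M[R]_n) (a : I -> R) :
  (forall i, F (p i)) -> \sum_i a i = 1 -> aff_hull F (\sum_i a i *: p i).
Proof.
move=> Fp a1; exists #|I|, (p \o enum_val), (a \o enum_val); split=> [i||].
- exact: Fp.
- by rewrite -a1 [RHS](reindex _ (onW_bij _ (@enum_val_bij I))).
- by rewrite [LHS](reindex _ (onW_bij _ (@enum_val_bij I))).
Qed.

Lemma sub_aff_hull F : F `<=` aff_hull F.
Proof.
by move=> X FX; exists 1%N, (fun=> X), (fun=> 1); split=> //;
  rewrite big_ord1 ?scale1r.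
Qed.

Lemma conv_hull_aff_hull S : conv_hull S `<=` aff_hull S.
Proof. by move=> X [k [p [a [Sp _ a1 XE]]]]; exists k, p, a. Qed.

Lemma aff_hull_sub_vspace F X0 (U : {vspace 'M[R]_n}) :
  F `<=` [set X | X - X0 \in U] -> aff_hull F `<=` [set X | X - X0 \in U].
Proof.
move=> FU _ [k [p [a [Fp a1 ->]]]] /=.
rewrite -[X0]scale1r -a1 scaler_suml -sumrB; apply: rpred_sum => i _.
by rewrite -scalerBr; apply/rpredZ/FU.
Qed.

Definition aff_direction F (x : 'M[R]_n) : Prop :=
  forall Y t, aff_hull F Y -> aff_hull F (Y + t *: x).

Lemma aff_directionB F A B : F A -> F B -> aff_direction F (B - A).
Proof.
move=> FA FB _ t [k [p [a [Fp a1 ->]]]].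
pose q (i : 'I_k + bool) :=
  match i with inl l => p l | inr s => if s then B else A end.
pose w (i : 'I_k + bool) :=
  match i with inl l => a l | inr s => if s then t else - t end.
have -> : \sum_i a i *: p i + t *: (B - A) = \sum_i w i *: q i.
  by rewrite big_sumType /= big_bool /= scalerBr scaleNr.
apply: aff_hull_comb => [[l|[]] /=|]; [exact: Fp|exact: FB|exact: FA|].
by rewrite big_sumType /= big_bool /= a1 subrr addr0.
Qed.

Lemma aff_direction_sum F (I : finType) (x : I -> 'M[R]_n) :
  (forall i, aff_direction F (x i)) -> aff_direction F (\sum_i x i).
Proof.
move=> Fx Y t FY; rewrite scaler_sumr; elim/big_rec: _ => [|i y _ Fy].
  by rewrite addr0.
by rewrite addrA addrAC; exact: Fx.
Qed.

Lemma has_dim_span F X0 m (b : m.-tuple 'M[R]_n) : F X0 ->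
  F `<=` [set X | X - X0 \in <<b>>%VS] ->
  (forall i : 'I_m, aff_direction F b`_i) -> has_dim F (\dim <<b>>).
Proof.
move=> FX0 F_sub Fb; exists X0, <<b>>%VS; split=> //.
apply/seteqP; split=> [|X /= Xb]; first exact: aff_hull_sub_vspace.
rewrite -[X](subrK X0) addrC (coord_span Xb).
elim/big_rec: _ => [|i Y _ FY]; first by rewrite addr0; exact: sub_aff_hull.
by rewrite addrA addrAC; exact: Fb.
Qed.

Lemma has_dim_uniq F d d' : has_dim F d -> has_dim F d' -> d = d'.
Proof.
have sub (X0 X1 : 'M[R]_n) (U U' : {vspace 'M[R]_n}) :
    [set X | X - X0 \in U] `<=` [set X | X - X1 \in U'] -> (U <= U')%VS.
  move=> UU'; have /= := UU' X0; rewrite subrr mem0v => /(_ isT) X01.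
  apply/subvP => u uU; have /= := UU' (u + X0); rewrite addrK => /(_ uU) uX.
  by have := rpredB uX X01; rewrite opprB addrA subrK addrK.
move=> [X0 [U [UE <-]]] [X1 [U' [U'E <-]]]; rewrite UE in U'E.
apply/eqP; rewrite eqn_leq; apply/andP; split; apply: dimvS.
  by apply: (sub X0 X1); rewrite U'E.
by apply: (sub X1 X0); rewrite U'E.
Qed.

Lemma has_dim_nonempty F d : has_dim F d -> F !=set0.
Proof.
move=> [X0 [U [UE _]]]; have : aff_hull F X0 by rewrite UE /= subrr mem0v.
by move=> [k [p [a [Fp /sum1_neq0[i _] _]]]]; exists (p i).
Qed.

End AffineHulls.

(** * Faces and their flow grids *)

Section GridFaces.
Variables (R : realType) (n : nat).
Implicit Types (A B : 'M[R]_n) (G : grid n) (F : set 'M[R]_n).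
Local Open Scope ring_scope.
Local Open Scope classical_set_scope.
Local Notation vtx := (vtx n).

Lemma partial_sum_linear i j (e : edge n) :
  scalar (fun A : 'M[R]_n => partial_sum A i j e).
Proof.
move=> a A B; rewrite /partial_sum.
by do 3?[case: ifP => _]; rewrite mulr_sumr -big_split; apply: eq_bigr => k _;
  rewrite !mxE.
Qed.

Lemma ASM_partial_sum A i j (e : edge n) : is_ASM A ->
  partial_sum A i j e = 0 \/ partial_sum A i j e = 1.
Proof.
move=> /ASM_lines[rowA colA].
have suffix01 (a : 'I_n -> R) m : asm_line a ->
    \sum_(k < n | (m <= k)%N) a k = 0 \/ \sum_(k < n | (m <= k)%N) a k = 1.
  move=> a_line; rewrite suffix_sum; have [_ -> _] := a_line.
  have [->|->] := asm_line_prefix_sum m a_line; first by right; rewrite subr0.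
  by left; rewrite subrr.
rewrite /partial_sum; case: ifP => _; last case: ifP => _; last case: ifP => _.
- exact: (asm_line_prefix_sum j.+1 (rowA i)).
- exact: suffix01.
- exact: (asm_line_prefix_sum i.+1 (colA j)).
- exact: (suffix01 (A^~ j)).
Qed.

Definition edge_sum (e : edge n) A : R :=
  \sum_(i < n) \sum_(j < n) (e.1 == vtx i.+1 j.+1)%:R * partial_sum A i j e.

Lemma edge_sum_linear e : scalar (edge_sum e).
Proof.
move=> a A B; rewrite /edge_sum mulr_sumr -big_split; apply: eq_bigr => i _ /=.
rewrite mulr_sumr -big_split; apply: eq_bigr => j _ /=.
by rewrite partial_sum_linear; ring.
Qed.

Lemma edge_sum_ASM A e : is_ASM A -> e \in complete_flow_grid n ->
  edge_sum e A = (e \in flow_grid_of A)%:R.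
Proof.
case: e => v w asmA vwC; have : internal v by move: vwC; rewrite inE => /andP[].
case/internal_vtxP => i [j [i_n jn vE]]; move: vwC; rewrite {v}vE => vwC.
have eq_ord (k : nat) (kn : (k < n)%N) (l : 'I_n) :
    (k == l) = (l == Ordinal kn).
  by rewrite -val_eqE eq_sym.
rewrite (mem_flow_grid A (Ordinal i_n) (Ordinal jn)) vwC /edge_sum /=.
have at_vtx (k l : 'I_n) :
    (vtx i.+1 j.+1 == vtx k.+1 l.+1) = (k == Ordinal i_n) && (l == Ordinal jn).
  have kn := ltn_ord k; have ln := ltn_ord l.
  by rewrite eq_vtx ?eqSS ?(eq_ord _ i_n) ?(eq_ord _ jn) //; lia.
rewrite (bigD1 (Ordinal i_n)) //= (bigD1 (Ordinal jn)) //= eqxx mul1r.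
rewrite [X in _ + X + _]big1 ?addr0 => [|l /negbTE lj]; last first.
  by rewrite (at_vtx (Ordinal i_n)) lj andbF mul0r.
rewrite big1 ?addr0 => [|k /negbTE ki]; last first.
  by rewrite big1 // => l _; rewrite at_vtx ki mul0r.
set e := (vtx i.+1 j.+1, w).
have [->|->] := ASM_partial_sum (Ordinal i_n) (Ordinal jn) e asmA.
  by rewrite eq_sym oner_eq0.
by rewrite eqxx.
Qed.

(* The functional counts the edges of the flow grid that are not in [G]. *)
Lemma exposing_functional G : exists C, forall A, is_ASM A ->
  dotmx C A <= 0 /\ (dotmx C A = 0 <-> flow_grid_of A \subset G).
Proof.
have [|C CE] := @scalar_dotmx R n
    (fun A => - \sum_(e in complete_flow_grid n :\: G) edge_sum e A).
  move=> a A B; rewrite mulrN -opprD mulr_sumr -big_split.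
  by congr (- _); apply: eq_bigr => e _; rewrite edge_sum_linear.
exists C => A asmA.
have -> : dotmx C A = - #|flow_grid_of A :\: G|%:R.
  rewrite CE -sum1_card natr_sum big_mkcond [in RHS]big_mkcond; congr (- _).
  apply: eq_bigr => e _; rewrite !finset.in_setD.
  have [eC|eC] := boolP (e \in complete_flow_grid n).
    by rewrite andbT edge_sum_ASM //; case: (e \in G);
      case: (e \in flow_grid_of A).
  rewrite andbF; have /negbTE-> : e \notin flow_grid_of A.
    by apply: contra eC; exact: (fintype.subsetP (flow_grid_complete A)).
  by rewrite andbF.
rewrite oppr_le0 ler0n; split=> //; split=> [/eqP|AG].
  by rewrite oppr_eq0 pnatr_eq0 cards_eq0 finset.setD_eq0.
by apply/eqP; rewrite oppr_eq0 pnatr_eq0 cards_eq0 finset.setD_eq0.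
Qed.

Lemma flow_grid_inj A B : is_ASM A -> is_ASM B ->
  flow_grid_of A \subset flow_grid_of B -> A = B.
Proof.
move=> /ASM_height[h h_height ->] /ASM_height[h' h'_height ->].
rewrite !flow_grid_of_asm // => /fintype.subsetP sub; apply: eq_asm_of.
elim=> [|i IHi] j i_n jn.
  by rewrite (height0l _ h_height) (height0l _ h'_height).
have := height_down h_height i_n jn; have := height_down h'_height i_n jn.
have := sub (segment n true i j); have := sub (reversed (segment n true i j)).
have := IHi j (ltnW i_n) jn.
rewrite !segment_height_grid ?reversed_segment_height_grid //=;
  rewrite ?addn0 ?addn1 //; lia.
Qed.

Definition ASM_within G : set 'M[R]_n :=
  [set A | is_ASM A /\ flow_grid_of A \subset G].

Definition grid_face G : set 'M[R]_n := conv_hull (ASM_within G).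

Lemma grid_face_exposed G : exists C,
  @is_ASM R n `<=` [set A | dotmx C A <= 0] /\
  forall S : set 'M[R]_n, S `<=` @is_ASM R n ->
    [set A | S A /\ dotmx C A = 0] = S `&` ASM_within G.
Proof.
have [C CG] := exposing_functional G; exists C; split=> [A /CG[]//|S S_asm].
apply/seteqP; split=> A [SA] /=.
  by move/(CG A (S_asm A SA)).2 => AG; split=> //; split=> //; exact: S_asm.
by move=> [asmA AG]; split=> //; apply/(CG A asmA).2.
Qed.

Lemma is_face_grid_face G : is_face (@ASM_polytope R n) (grid_face G).
Proof.
have [C [C_le0 CG]] := grid_face_exposed G.
have := is_face_conv_hull C_le0; rewrite (CG (@is_ASM R n)) // setIidr //.
by move=> A [].
Qed.

Lemma ASM_within_flow_grid A : is_ASM A ->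
  ASM_within (flow_grid_of A) = [set A].
Proof.
move=> asmA; apply/seteqP; split=> [B [asmB /flow_grid_inj]|_ ->];
  last by split.
exact.
Qed.

Lemma ASM_grid_face G A :
  is_ASM A -> grid_face G A <-> flow_grid_of A \subset G.
Proof.
move=> asmA; split=> [AG|AG]; last exact: sub_conv_hull.
have [C [C_le0 CG]] := grid_face_exposed G.
have within : @is_ASM R n `&` ASM_within G = ASM_within G.
  by apply: setIidr => B [].
have := conv_hull_max C_le0.
rewrite (CG (@is_ASM R n)) // within => polytope_max.
have [_ CA] : ASM_polytope A /\ dotmx C A = 0.
  by move: (A) AG; rewrite /grid_face -polytope_max.
have : [set B | is_ASM B /\ dotmx C B = 0] A by [].
by rewrite (CG (@is_ASM R n)) // => -[_ []].
Qed.

Lemma face_vertex F A : is_face (@ASM_polytope R n) F ->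
  is_vertex F A <-> is_ASM A /\ F A.
Proof.
move=> /face_conv_hull FE; split=> [|[asmA FA]].
  rewrite /is_vertex {1}FE => /face_conv_hull AE.
  have [B [[asmB FB] BA]] : (@is_ASM R n `&` F) `&` [set A] !=set0.
    by apply: conv_hull_nonempty; rewrite -AE; exists A.
  by rewrite -BA.
have [C [C_le0 CG]] := grid_face_exposed (flow_grid_of A).
have only_A : @is_ASM R n `&` F `&` ASM_within (flow_grid_of A) = [set A].
  by rewrite ASM_within_flow_grid //; apply: setIidr => _ ->.
have := @is_face_conv_hull _ _ (@is_ASM R n `&` F) C 0.
rewrite -FE (CG (@is_ASM R n `&` F)) ?only_A ?conv_hull1; last exact: subIsetl.
by apply=> B [/C_le0].
Qed.

Lemma mem_flow_grid_of_face F e : is_face (@ASM_polytope R n) F ->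
  e \in flow_grid_of_face F <->
  exists A, [/\ is_ASM A, F A & e \in flow_grid_of A].
Proof.
move=> F_face; rewrite inE; split=> [/asboolP[A +]|].
  by move=> /(face_vertex A F_face)[asmA FA] eA; exists A.
by move=> [A [asmA FA eA]]; apply/asboolP; exists A => //; apply/face_vertex.
Qed.

Lemma face_ASM F : is_face (@ASM_polytope R n) F -> F !=set0 ->
  exists A, is_ASM A /\ F A.
Proof. by move=> /face_conv_hull {1}-> /conv_hull_nonempty. Qed.

Lemma flow_grid_of_face_sub F A : is_face (@ASM_polytope R n) F ->
  is_ASM A -> F A -> flow_grid_of A \subset flow_grid_of_face F.
Proof.
move=> F_face asmA FA; apply/fintype.subsetP => e eA.
by apply/(mem_flow_grid_of_face e F_face); exists A.
Qed.

Lemma flow_grid_of_face_elementary F : is_face (@ASM_polytope R n) F ->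
  elementary_flow_grid (flow_grid_of_face F).
Proof.
move=> F_face.
exists [set S : grid n |
         `[< exists A, [/\ is_ASM A, F A & flow_grid_of A = S] >]]%SET.
  by move=> S; rewrite inE => /asboolP[A [asmA _ <-]];
    exact: flow_grid_of_ASM_simple.
apply/setP => e; apply/idP/finset.bigcupP => [|[S]].
  move=> /(mem_flow_grid_of_face e F_face)[A [asmA FA eA]].
  by exists (flow_grid_of A) => //; rewrite inE; apply/asboolP; exists A.
rewrite inE => /asboolP[A [asmA FA <-]].
exact: (fintype.subsetP (flow_grid_of_face_sub F_face asmA FA)).
Qed.

End GridFaces.

Section FacesAndHeights.
Variables (R : realType) (n : nat).
Implicit Types (A B : 'M[R]_n) (G : grid n) (F : set 'M[R]_n).
Local Open Scope ring_scope.
Local Open Scope classical_set_scope.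
Local Notation asm_of := (asm_of R n).

Lemma face_height F : is_face (@ASM_polytope R n) F -> F !=set0 ->
  exists (N : nat) (A : 'I_N -> 'M[R]_n) (H : nat -> nat -> nat),
  [/\ (0 < N)%N, forall k, is_ASM (A k) /\ F (A k), height n N H,
      asm_of H = \sum_k A k & height_grid n N H = flow_grid_of_face F].
Proof.
move=> F_face /(face_ASM F_face)[A0 [asmA0 FA0]].
pose X := [set S : grid n | `[< exists h,
  [/\ height n 1 h, F (asm_of h) & height_grid n 1 h = S] >]]%SET.
have memX A : is_ASM A -> F A -> flow_grid_of A \in X.
  move=> /ASM_height[h h_height ->] Fh; rewrite inE.
  by apply/asboolP; exists h; split; rewrite ?flow_grid_of_asm.
have /choice[h hP] (k : 'I_#|X|) : exists h,
    [/\ height n 1 h, F (asm_of h) & height_grid n 1 h = enum_val k].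
  by have := enum_valP k; rewrite inE => /asboolP.
have h_height k : height n 1 (h k) by case: (hP k).
have hF k : is_ASM (asm_of (h k)) /\ F (asm_of (h k)).
  by case: (hP k) => _ Fh _; split=> //; exact: asm_of_ASM.
exists #|X|, (fun k => asm_of (h k)), (fun i j => \sum_k h k i j)%N; split=> //.
- by apply/card_gt0P; exists (flow_grid_of A0); exact: memX.
- by have := height_sum h_height; rewrite card_ord.
- exact: asm_of_sum.
have := height_grid_sum h_height; rewrite card_ord => ->.
apply/setP => e; apply/finset.bigcupP/idP => [[k _]|].
  rewrite -(flow_grid_of_asm R (h_height k)); case: (hF k) => asm_hk F_hk.
  exact: fintype.subsetP (flow_grid_of_face_sub F_face asm_hk F_hk) e.
move=> /(mem_flow_grid_of_face e F_face)[A [asmA FA eA]].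
have AX := memX A asmA FA; exists (enum_rank_in AX (flow_grid_of A)) => //.
by case: (hP (enum_rank_in AX (flow_grid_of A))) => _ _ ->;
  rewrite enum_rankK_in.
Qed.

(* Subtracting [B] from a sum of [N] vertices of [F] and rounding the rest gives
   a sum of [N] alternating sign matrices containing [B] at which the functional
   defining [F] is maximal. *)
Lemma face_contains F B : is_face (@ASM_polytope R n) F -> F !=set0 ->
  is_ASM B -> flow_grid_of B \subset flow_grid_of_face F -> F B.
Proof.
move=> F_face F_neq0 asmB sub.
have [N [A [H [N_gt0 FA H_height H_sum H_grid]]]] := face_height F_face F_neq0.
have [h h_height BE] := ASM_height asmB; move: sub.
rewrite BE flow_grid_of_asm // -H_grid =>
  /(height_sub H_height h_height)[K_height le_hH].
set K := (fun i j => H i j - h i j)%N in K_height.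
pose D (k : 'I_N.-1) := asm_of (rounding N.-1 k K).
have sum_D : \sum_k D k + asm_of h = \sum_k A k.
  rewrite -H_sum -asm_of_sum -asm_ofD; apply: eq_asm_of => i j i_n jn.
  by rewrite (sum_rounding _ _ K_height) subnK ?le_hH.
have [C [b [Cb FE]]] := F_face.
have C_le A' : is_ASM A' -> dotmx C A' <= b by move/sub_conv_hull/Cb.
have C_sum : \sum_k dotmx C (D k) + dotmx C (asm_of h) = N%:R * b.
  rewrite -dotmx_sum -dotmxD sum_D dotmx_sum (eq_bigr (fun=> b)) => [|k _].
    by rewrite sumr_const card_ord mulr_natl.
  by have [_] := FA k; rewrite FE => -[].
have C_D : \sum_k dotmx C (D k) <= N.-1%:R * b.
  rewrite mulr_natl -[X in b *+ X]card_ord -sumr_const; apply: ler_sum => k _.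
  by apply/C_le/asm_of_ASM/height_rounding.
have C_h : dotmx C (asm_of h) <= b by apply/C_le/asm_of_ASM.
rewrite FE; split; first exact/sub_conv_hull/asm_of_ASM.
have NE : N%:R * b = N.-1%:R * b + b.
  by rewrite -{1}(prednK N_gt0) -natr1 mulrDl mul1r.
by apply/le_anti; rewrite C_h /=; lra.
Qed.

Lemma face_grid_face F : is_face (@ASM_polytope R n) F -> F !=set0 ->
  F = grid_face (flow_grid_of_face F).
Proof.
move=> F_face F_neq0; rewrite [LHS](face_conv_hull F_face); congr conv_hull.
apply/seteqP; split=> A [asmA FA]; split=> //; last exact: face_contains.
exact: flow_grid_of_face_sub.
Qed.

Lemma flow_grid_of_grid_face G : elementary_flow_grid G ->
  flow_grid_of_face (@grid_face R n G) = G.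
Proof.
move=> G_elem; apply/setP => e; apply/idP/idP.
  move=> /(mem_flow_grid_of_face e (is_face_grid_face _ _))[A [asmA GA]].
  exact/fintype.subsetP/(ASM_grid_face _ asmA).1.
move=> /(elementary_covered R G_elem)[h [h_height hG eh]].
apply/(mem_flow_grid_of_face e (is_face_grid_face _ _)); exists (asm_of h).
have asm_h := asm_of_ASM R h_height; rewrite flow_grid_of_asm //; split=> //.
by apply/ASM_grid_face => //; rewrite flow_grid_of_asm.
Qed.

Lemma grid_face_nonempty G : elementary_flow_grid G -> G != finset.set0 ->
  @grid_face R n G !=set0.
Proof.
move=> G_elem /finset.set0Pn[e].
move=> /(elementary_covered R G_elem)[h [h_height hG _]].
exists (asm_of h); apply/ASM_grid_face; first exact: asm_of_ASM.
by rewrite flow_grid_of_asm.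
Qed.

End FacesAndHeights.

(** * The dimension of a face *)

Section Dimension.
Variables (R : realType) (n : nat).
Implicit Types (A B : 'M[R]_n) (G : grid n) (F : set 'M[R]_n).
Local Open Scope ring_scope.
Local Notation asm_of := (asm_of R n).

Lemma mixed_diff_comb k (a : 'I_k -> R) (f : 'I_k -> nat -> nat -> R) :
  mixed_diff n (fun i j => \sum_l a l * f l i j) =
    \sum_l a l *: mixed_diff n (f l).
Proof.
apply/matrixP => i j; rewrite mxE summxE -!sumrB.
by apply: eq_bigr => l _; rewrite !mxE; ring.
Qed.

Definition regions G : {set {set cell n}} :=
  [set S | doubly_directed_region G S]%SET.

Definition region_mx (S : {set cell n}) : 'M[R]_n := asm_of (indicator S).

Definition region_tuple G : (num_regions G).-tuple 'M[R]_n :=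
  [tuple region_mx (enum_val i) | i < #|regions G|].

Lemma region_enum_val G (i : 'I_#|regions G|) :
  doubly_directed_region G (enum_val i).
Proof. by have := enum_valP i; rewrite inE. Qed.

Lemma nth_region_tuple G (i : 'I_#|regions G|) :
  (region_tuple G)`_i = region_mx (enum_val i).
Proof. by rewrite -tnth_nth tnth_mktuple. Qed.

Lemma region_tuple_free G : free (region_tuple G).
Proof.
apply/freeP => a comb0 i.
pose f k l : R := \sum_(S < #|regions G|) a S * (indicator (enum_val S) k l)%:R.
have diff0 : mixed_diff n f = 0.
  rewrite mixed_diff_comb -[RHS]comb0; apply: eq_bigr => S _.
  by rewrite nth_region_tuple.
have f_outer k l : ~~ inner n k l -> f k l = 0.
  by move=> kl; rewrite /f big1 // => S _; rewrite indicator_outer // mulr0.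
have [c c_i] := region_cell (region_enum_val i).
have : at_cell f c = 0.
  have /andP[/andP[_ i_n] /andP[_ jn]] := inner_cell c.
  rewrite /at_cell -(mixed_diffK _ _ (ltnW i_n) (ltnW jn)) => [|l|k];
    last 2 first.
  - by apply: f_outer.
  - by apply: f_outer; rewrite /inner ltnn andbF.
  rewrite diff0 /corner_sum /prefix_sum big1 // => k _.
  by rewrite big1 // => l _; rewrite mxE.
rewrite /at_cell /f (bigD1 i) //= -[indicator _ _ _]/(at_cell _ c).
rewrite indicator_cell c_i mulr1 big1 ?addr0 // => S Si.
rewrite -[indicator _ _ _]/(at_cell _ c) indicator_cell.
have [c_S|_] := boolP (c \in enum_val S); last by rewrite mulr0.
case/eqP: Si; apply: enum_val_inj.
rewrite (region_component R (region_enum_val S) c_S).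
by rewrite -(region_component R (region_enum_val i) c_i).
Qed.

Lemma face_ASM_subB F A B : is_face (@ASM_polytope R n) F ->
  is_ASM A -> F A -> is_ASM B -> F B ->
  A - B \in <<region_tuple (flow_grid_of_face F)>>%VS.
Proof.
move=> F_face asmA FA asmB FB; set G := flow_grid_of_face F.
have G_elem : elementary_flow_grid G := flow_grid_of_face_elementary F_face.
have := flow_grid_of_face_sub F_face asmA FA.
have := flow_grid_of_face_sub F_face asmB FB.
have [h h_height ->] := ASM_height asmA.
have [h' h'_height ->] := ASM_height asmB.
rewrite !flow_grid_of_asm // => h'G hG.
have dG := compat_height_diff R h_height h'_height hG h'G.
set d := (fun i j => _) in dG.
have -> : asm_of h - asm_of h' = mixed_diff n d.
  by apply/matrixP => i j; rewrite !mxE /d; ring.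
pose f i j : R := \sum_(S < #|regions G|)
  value_on d (enum_val S) * (indicator (enum_val S) i j)%:R.
have -> : mixed_diff n d = mixed_diff n f.
  congr mixed_diff; apply/funext => i; apply/funext => j.
  rewrite (compat_decomp G_elem i j dG) /f.
  pose term (S : {set cell n}) : R := value_on d S * (indicator S i j)%:R.
  rewrite -(@big_enum_val _ _ _ _ (mem (regions G)) term) /=.
  by apply: eq_bigl => S; rewrite inE.
rewrite mixed_diff_comb; apply: rpred_sum => S _; apply/rpredZ/memv_span.
by apply/tnthP; exists S; rewrite tnth_mktuple.
Qed.

Lemma region_mx_direction F (S : {set cell n}) :
  is_face (@ASM_polytope R n) F -> (F !=set0)%classic ->
  doubly_directed_region (flow_grid_of_face F) S ->
    aff_direction F (region_mx S).
Proof.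
move=> F_face F_neq0.
have [N [A [H [_ FA H_height H_sum H_grid]]]] := face_height F_face F_neq0.
rewrite -H_grid => /(height_add_region H_height)[].
set K := (fun i j => _) => K_height K_grid.
pose B (k : 'I_N) := asm_of (rounding N k K).
have -> : region_mx S = \sum_k (B k - A k).
  rewrite sumrB -H_sum -asm_of_sum (@eq_asm_of _ _ _ K) => [|i j _ _];
    last exact: sum_rounding K_height.
  by rewrite asm_ofD addrAC subrr add0r.
apply: aff_direction_sum => k; have [_ FAk] := FA k.
apply: aff_directionB => //.
have B_height := height_rounding (ltn_ord k) K_height.
apply: face_contains => //; first exact: asm_of_ASM.
rewrite flow_grid_of_asm // -H_grid; apply: fintype.subset_trans K_grid.
exact: rounding_grid.
Qed.

Lemma face_dim F : is_face (@ASM_polytope R n) F -> (F !=set0)%classic ->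
  has_dim F (num_regions (flow_grid_of_face F)).
Proof.
move=> F_face F_neq0; set G := flow_grid_of_face F.
have [A0 [asmA0 FA0]] := face_ASM F_face F_neq0.
have <- : \dim <<region_tuple G>> = num_regions G.
  by have := region_tuple_free G; rewrite /free size_tuple => /eqP.
apply: (has_dim_span FA0) => [|i].
  rewrite [X in (X `<=` _)%classic](face_conv_hull F_face).
  move=> X /conv_hull_aff_hull; apply: aff_hull_sub_vspace => A [asmA FA].
  exact: face_ASM_subB.
by rewrite nth_region_tuple; apply: region_mx_direction => //;
  exact: region_enum_val.
Qed.

End Dimension.

Theorem theorem4p4 (R : realType) (n : nat) :
  (forall F : set 'M[R]_n,
     is_face (@ASM_polytope R n) F -> (F !=set0)%classic ->
     has_dim F (num_regions (flow_grid_of_face F))) /\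
  (forall F : set 'M[R]_n,
     is_face (@ASM_polytope R n) F -> has_dim F 1 ->
     elementary_flow_grid (flow_grid_of_face F) /\
     exists! E : {set edge n}, double_directed_cycle (flow_grid_of_face F) E) /\
  (forall G : grid n,
     elementary_flow_grid G ->
     (exists! E : {set edge n}, double_directed_cycle G E) ->
     exists! F : set 'M[R]_n,
       [/\ is_face (@ASM_polytope R n) F, has_dim F 1
         & flow_grid_of_face F = G]).
Proof.
split; first by move=> F; exact: face_dim.
split=> [F F_face F_dim1|G G_elem G_cycle].
  have G_elem := flow_grid_of_face_elementary F_face; split=> //.
  apply: (one_region_one_cycle R G_elem).
  exact: has_dim_uniq (face_dim F_face (has_dim_nonempty F_dim1)) F_dim1.
have [E [/double_directed_cycle_neq0 G_neq0 _]] := G_cycle.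
have gridG := flow_grid_of_grid_face R G_elem.
exists (@grid_face R n G); split=> [|F [F_face F_dim1 <-]].
  split=> //; first exact: is_face_grid_face.
  rewrite -(one_cycle_one_region R G_elem G_cycle) -[in num_regions _]gridG.
  by apply: face_dim; [exact: is_face_grid_face|exact: grid_face_nonempty].
exact/esym/face_grid_face/(has_dim_nonempty F_dim1).
Qed.
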